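(* Assume $\Delta_T\to\infty$, $T/\Delta_T\to\infty$ as $T\to\infty$, and $T/\Delta_T^{5/4}=o\big((\log(T/\Delta_T))^{-1/4}\big)$. Then for every $\vartheta\in\Theta$ the family $(\mathcal E^{T,\Delta_T})_{T>0}$ satisfies the LAN property at $\vartheta$ with normalisation $I_{T,\infty}(\vartheta)=\dfrac{T\Delta_T^{-1}}{2\vartheta^2}$.
   Context: Model: $\Theta\subseteq(0,\infty)$ open. Under $\mathbb P_\vartheta$, $X_t=\sum_{i=1}^{N_t}\varepsilon_i$ ($X_0=0$), $(N_t)$ homogeneous Poisson of intensity $\vartheta$, $\varepsilon_i$ i.i.d. independent of $(N_t)$ with $\mathbb P(\varepsilon_i=\pm1)=1/2$. The experiment $\mathcal E^{T,\Delta}=\{\mathbb P^{T,\Delta}_\vartheta,\vartheta\in\Theta\}$ consists of the law of $(X_0,X_\Delta,\dots,X_{\lfloor T/\Delta\rfloor\Delta})$. LAN: the family satisfies LAN at $\vartheta$ with normalisation $I_T(\vartheta)>0$ if for every $v$ with $\vartheta+vI_T(\vartheta)^{-1/2}\in\Theta$, $\frac{d\mathbb P^{T,\Delta_T}_{\vartheta+vI_T(\vartheta)^{-1/2}}}{d\mathbb P^{T,\Delta_T}_\vartheta}=\exp(v\xi_T-\tfrac12v^2+r_T)$ with $\xi_T\to\mathcal N(0,1)$ in distribution and $r_T\to0$ in probability under $\mathbb P^{T,\Delta_T}_\vartheta$. *)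

(* Defs.v *)
From Stdlib Require Import Reals Lra ZArith List ClassicalEpsilon.
Open Scope R_scope.

Definition seq_lim (u : nat -> R) : R :=
  epsilon (inhabits 0) (fun l => Un_cv u l).

Definition tends_at_infty (f : R -> R) (l : R) : Prop :=
  forall eps, eps > 0 -> exists T0, forall T, T >= T0 -> Rabs (f T - l) < eps.

Definition diverges_at_infty (f : R -> R) : Prop :=
  forall B, exists T0, forall T, T >= T0 -> f T > B.

(* law of S_m = eps_1 + ... + eps_m, eps_i iid uniform on {-1,+1}:
   rad_pmf m k = P(S_m = k) *)
Fixpoint rad_pmf (m : nat) (k : Z) : R :=
  match m with
  | O => if Z.eq_dec k 0 then 1 else 0
  | S m' => (rad_pmf m' (k - 1) + rad_pmf m' (k + 1)) / 2
  end.

(* law of the increment X_{t+Delta} - X_t = sum_{i <= N} eps_i with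
   N ~ Poisson(lam), lam = theta * Delta :
   incr_pmf lam k = sum_{m >= 0} e^{-lam} lam^m / m! * P(S_m = k) *)
Definition incr_pmf (lam : R) (k : Z) : R :=
  seq_lim (fun M => sum_f_R0
    (fun m => exp (- lam) * lam ^ m / INR (fact m) * rad_pmf m k) M).

Fixpoint path_prod (lam : R) (prev : Z) (l : list Z) : R :=
  match l with
  | nil => 1
  | y :: l' => incr_pmf lam (y - prev) * path_prod lam y l'
  end.

Definition nobs (T Delta : R) : nat := Z.to_nat (Int_part (T / Delta)).

(* pmf of the observation vector (X_0, X_Delta, ..., X_{n Delta}),
   n = floor(T/Delta), under P_theta; X_0 = 0. Observations are lists of
   integers; lists of the wrong length or with X_0 <> 0 have mass 0. *)
Definition obs_pmf (theta T Delta : R) (x : list Z) : R :=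
  match x with
  | nil => 0
  | z0 :: rest =>
      if Z.eq_dec z0 0 then
        if Nat.eq_dec (length rest) (nobs T Delta)
        then path_prod (theta * Delta) z0 rest else 0
      else 0
  end.

Fixpoint boxsum (len M : nat) (f : list Z -> R) : R :=
  match len with
  | O => f nil
  | S len' =>
      sum_f_R0 (fun i => boxsum len' M
                 (fun l => f ((Z.of_nat i - Z.of_nat M)%Z :: l))) (2 * M)
  end.

(* expectation of a (nonnegative) function g of the observation under
   P^{T,Delta}_theta: sum over Z^{n+1} of pmf * g (limit of box sums) *)
Definition obs_expect (theta T Delta : R) (g : list Z -> R) : R :=
  seq_lim (fun M => boxsum (S (nobs T Delta)) M
                      (fun x => obs_pmf theta T Delta x * g x)).

Definition prob_le (theta T Delta : R) (f : list Z -> R) (c : R) : R :=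
  obs_expect theta T Delta (fun x => if Rle_dec (f x) c then 1 else 0).
Definition prob_abs_gt (theta T Delta : R) (f : list Z -> R) (c : R) : R :=
  obs_expect theta T Delta (fun x => if Rlt_dec c (Rabs (f x)) then 1 else 0).

Definition lik_ratio (theta' theta T Delta : R) (x : list Z) : R :=
  obs_pmf theta' T Delta x / obs_pmf theta T Delta x.

Definition gauss (t : R) : R := exp (- t ^ 2 / 2) / sqrt (2 * PI).

Definition is_std_normal_cdf (Phi : R -> R) : Prop :=
  (forall t, derivable_pt_lim Phi t (gauss t)) /\
  (forall eps, eps > 0 -> exists A, forall t, t <= A -> Rabs (Phi t) < eps).

Definition conv_std_normal (theta : R) (Delta : R -> R)
    (xi : R -> list Z -> R) : Prop :=
  forall Phi, is_std_normal_cdf Phi ->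
  forall c, tends_at_infty (fun T => prob_le theta T (Delta T) (xi T) c) (Phi c).

Definition conv_prob_zero (theta : R) (Delta : R -> R)
    (r : R -> list Z -> R) : Prop :=
  forall eps, eps > 0 ->
  tends_at_infty (fun T => prob_abs_gt theta T (Delta T) (r T) eps) 0.

Definition LAN (theta : R) (Delta : R -> R) (I : R -> R) : Prop :=
  exists xi : R -> list Z -> R,
    conv_std_normal theta Delta xi /\
    forall v : R,
      conv_prob_zero theta Delta
        (fun T x => ln (lik_ratio (theta + v / sqrt (I T)) theta T (Delta T) x)
                    - v * xi T x + v ^ 2 / 2).

(* Main.v *)
(** Let [x = theta * Delta].  An increment has the Skellam law
    [p(x, k) = e^(-x) I_k(x)], with [I_k] the modified Bessel function, so its
    score is [k/x + I_(k+1)(x)/I_k(x) - 1].  The function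
    [x (I_k^2 - I_(k+1)^2) - (2k+1) I_k I_(k+1)] is nondecreasing and vanishes at
    [0]; this bounds the Bessel ratio from above, and the three-term recurrence
    turns the bound into one from below.  Hence the score equals the Gaussian
    score [- 1/(2x) + k^2/(2x^2)] up to [(2+|k|)/x^2 + k^4/x^4] for every [k],
    and no local limit theorem is needed: the log-likelihood ratio is that of
    Gaussian increments up to a remainder whose expectation is
    [O(sqrt (T / Delta / x))].  The central sequence is the normalised sum of
    [k_i^2/x - 1], to which Stein's method applies through the exact second,
    fourth and sixth Skellam moments. *)

Require Import Defs.
From Stdlib Require Import Reals ZArith List ClassicalEpsilon Lra Lia.
From Coquelicot Require Import Coquelicot.
Open Scope R_scope.

(** * Truncated sums over the integers *)

(** Probabilities in the model are values of a choice operator applied to limits of box sums, so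
    each one is shown to converge before it is estimated. All estimates are made at a fixed window
    [M], where the increment law has mass at most one and its moments are only nearly correct. These
    defects vanish as [M] grows with the number of observations held fixed; only afterwards does [T]
    tend to infinity. Moment bounds from above hold at every [M], which spares exchanges of infinite
    sums. The local parameter acts as a relative shift: with [nu = T / Delta], the alternative
    multiplies the increment variance [x] by [1 + h], where [h = v * sqrt 2 / sqrt nu]. The mean
    value theorem on this interval leaves about [Rabs h / sqrt x] per increment, and the growth
    condition has to control the sum of these. The floor in the number of observations, the excess
    kurtosis [/ x] and the terms of higher order in [h] give further errors, which vanish as [nu]
    and [x] grow. *)

Lemma seq_lim_eq (u : nat -> R) (l : R) : Un_cv u l -> seq_lim u = l.
Proof.
  intros H. apply (UL_sequence u); [|exact H].
  unfold seq_lim. apply epsilon_spec. now exists l.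
Qed.

Fixpoint zsum (M : nat) (f : Z -> R) : R :=
  match M with
  | O => f 0%Z
  | S M' => zsum M' f + f (Z.of_nat (S M')) + f (- Z.of_nat (S M'))%Z
  end.

Lemma zsum_ext M f g :
  (forall k, (Z.abs k <= Z.of_nat M)%Z -> f k = g k) -> zsum M f = zsum M g.
Proof.
  induction M as [|M IH]; intros H; cbn [zsum]; [apply H; lia|].
  rewrite IH by (intros k Hk; apply H; lia).
  rewrite 2!H by lia. reflexivity.
Qed.

Lemma zsum_le M f g :
  (forall k, (Z.abs k <= Z.of_nat M)%Z -> f k <= g k) -> zsum M f <= zsum M g.
Proof.
  induction M as [|M IH]; intros H; cbn [zsum]; [apply H; lia|].
  assert (zsum M f <= zsum M g) by (apply IH; intros k Hk; apply H; lia).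
  assert (f (Z.of_nat (S M)) <= g (Z.of_nat (S M))) by (apply H; lia).
  assert (f (- Z.of_nat (S M))%Z <= g (- Z.of_nat (S M))%Z) by (apply H; lia).
  lra.
Qed.

Lemma zsum_plus M f g : zsum M (fun k => f k + g k) = zsum M f + zsum M g.
Proof. induction M as [|M IH]; cbn [zsum]; [|rewrite IH]; lra. Qed.

Lemma zsum_minus M f g : zsum M (fun k => f k - g k) = zsum M f - zsum M g.
Proof. induction M as [|M IH]; cbn [zsum]; [|rewrite IH]; lra. Qed.

Lemma zsum_scal M c f : zsum M (fun k => c * f k) = c * zsum M f.
Proof. induction M as [|M IH]; cbn [zsum]; [|rewrite IH]; lra. Qed.

Lemma zsum_ge0 M f : (forall k, 0 <= f k) -> 0 <= zsum M f.
Proof.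
  intros H. induction M as [|M IH]; cbn [zsum]; [apply H|].
  pose proof (H (Z.of_nat (S M))). pose proof (H (- Z.of_nat (S M))%Z). lra.
Qed.

Lemma zsum_abs M f : Rabs (zsum M f) <= zsum M (fun k => Rabs (f k)).
Proof.
  induction M as [|M IH]; cbn [zsum]; [lra|].
  eapply Rle_trans; [apply Rabs_triang|].
  apply Rplus_le_compat_r.
  eapply Rle_trans; [apply Rabs_triang|]. lra.
Qed.

Lemma zsum_mono M M' f :
  (forall k, 0 <= f k) -> (M <= M')%nat -> zsum M f <= zsum M' f.
Proof.
  intros H. induction 1 as [|M' _ IH]; [lra|]. cbn [zsum].
  pose proof (H (Z.of_nat (S M'))). pose proof (H (- Z.of_nat (S M'))%Z). lra.
Qed.

Lemma zsum_succ M f :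
  zsum M (fun k => f (k + 1)%Z)
  = zsum M f + f (Z.of_nat M + 1)%Z - f (- Z.of_nat M)%Z.
Proof.
  induction M as [|M IH]; cbn [zsum].
  - change (0 + 1)%Z with 1%Z. change (Z.of_nat 0 + 1)%Z with 1%Z. change (- Z.of_nat 0)%Z with 0%Z. lra.
  - rewrite IH.
    replace (- Z.of_nat (S M) + 1)%Z with (- Z.of_nat M)%Z by lia.
    replace (Z.of_nat M + 1)%Z with (Z.of_nat (S M)) by lia. lra.
Qed.

Lemma zsum_pred M f :
  zsum M (fun k => f (k - 1)%Z)
  = zsum M f + f (- Z.of_nat M - 1)%Z - f (Z.of_nat M).
Proof.
  pose proof (zsum_succ M (fun k => f (k - 1)%Z)) as H. cbv beta in H.
  replace (Z.of_nat M + 1 - 1)%Z with (Z.of_nat M) in H by lia.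
  rewrite (zsum_ext M (fun k => f (k + 1 - 1)%Z) f) in H
    by (intros; f_equal; lia).
  lra.
Qed.

Lemma zsum_shift_nat (d M : nat) f :
  (forall k, 0 <= f k) ->
  zsum M (fun k => f (k + Z.of_nat d)%Z) <= zsum (M + d) f /\
  zsum M (fun k => f (k - Z.of_nat d)%Z) <= zsum (M + d) f.
Proof.
  intros Hf. revert M. induction d as [|d IH]; intros M.
  - rewrite Nat.add_0_r; split; apply Req_le, zsum_ext; intros; f_equal; lia.
  - destruct (IH (S M)) as [IH1 IH2].
    replace (M + S d)%nat with (S M + d)%nat by lia.
    split.
    + eapply Rle_trans; [|apply IH1].
      rewrite (zsum_ext M _ (fun k => (fun j => f (j + Z.of_nat d)%Z) (k + 1)%Z))
        by (intros; f_equal; lia).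
      rewrite (zsum_succ M (fun j => f (j + Z.of_nat d)%Z)). cbn [zsum].
      replace (Z.of_nat M + 1)%Z with (Z.of_nat (S M)) by lia.
      pose proof (Hf (- Z.of_nat M + Z.of_nat d)%Z).
      pose proof (Hf (- Z.of_nat (S M) + Z.of_nat d)%Z). lra.
    + eapply Rle_trans; [|apply IH2].
      rewrite (zsum_ext M _ (fun k => (fun j => f (j - Z.of_nat d)%Z) (k - 1)%Z))
        by (intros; f_equal; lia).
      rewrite (zsum_pred M (fun j => f (j - Z.of_nat d)%Z)). cbn [zsum].
      replace (- Z.of_nat M - 1)%Z with (- Z.of_nat (S M))%Z by lia.
      pose proof (Hf (Z.of_nat M - Z.of_nat d)%Z).
      pose proof (Hf (Z.of_nat (S M) - Z.of_nat d)%Z). lra.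
Qed.

Lemma zsum_shift (M M' : nat) (z : Z) f :
  (forall k, 0 <= f k) -> (Z.of_nat M + Z.abs z <= Z.of_nat M')%Z ->
  zsum M (fun k => f (k + z)%Z) <= zsum M' f.
Proof.
  intros Hf HM.
  apply Rle_trans with (zsum (M + Z.abs_nat z) f);
    [|apply zsum_mono; [exact Hf|lia]].
  destruct (zsum_shift_nat (Z.abs_nat z) M f Hf) as [H1 H2].
  destruct (Z_le_gt_dec 0 z) as [Hz|Hz].
  - eapply Rle_trans; [|exact H1]. apply Req_le, zsum_ext; intros; f_equal; lia.
  - eapply Rle_trans; [|exact H2]. apply Req_le, zsum_ext; intros; f_equal; lia.
Qed.

Lemma zsum_point M f : (forall k, k <> 0%Z -> f k = 0) -> zsum M f = f 0%Z.
Proof.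
  intros H. induction M as [|M IH]; cbn [zsum]; [reflexivity|].
  rewrite IH, (H (Z.of_nat (S M))), (H (- Z.of_nat (S M))%Z) by lia. lra.
Qed.

Lemma sum_f_R0_zsum M f :
  sum_f_R0 (fun i => f (Z.of_nat i - Z.of_nat M)%Z) (2 * M) = zsum M f.
Proof.
  revert f. induction M as [|M IH]; intros f; [reflexivity|].
  replace (2 * S M)%nat with (S (S (2 * M))) by lia.
  rewrite decomp_sum by lia.
  replace (pred (S (S (2 * M)))) with (S (2 * M)) by lia.
  cbn [sum_f_R0 zsum].
  rewrite <- IH.
  rewrite (sum_eq (fun i => f (Z.of_nat (S i) - Z.of_nat (S M))%Z)
                  (fun i => f (Z.of_nat i - Z.of_nat M)%Z))
    by (intros; f_equal; lia).
  replace (Z.of_nat 0 - Z.of_nat (S M))%Z with (- Z.of_nat (S M))%Z by lia.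
  replace (Z.of_nat (S (S (2 * M))) - Z.of_nat (S M))%Z with (Z.of_nat (S M)) by lia.
  lra.
Qed.

(* Truncating the increments rather than the positions keeps the product
   structure of the law; both truncations have the same limit. *)
Fixpoint incr_expect (lam : R) (n M : nat) (z : Z) (g : list Z -> R) : R :=
  match n with
  | O => g nil
  | S n' => zsum M (fun k => incr_pmf lam k *
      incr_expect lam n' M (z + k)%Z (fun l => g ((z + k)%Z :: l)))
  end.

Definition pos_expect (lam : R) (n M : nat) (z : Z) (g : list Z -> R) : R :=
  boxsum n M (fun l => path_prod lam z l * g l).

Lemma boxsum_ext n M f g :
  (forall l, length l = n -> f l = g l) -> boxsum n M f = boxsum n M g.
Proof.
  revert f g. induction n as [|n IH]; intros f g H; cbn [boxsum]; [now apply H|].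
  apply sum_eq. intros i _. apply IH. intros l Hl. apply H. cbn. now rewrite Hl.
Qed.

Lemma boxsum_scal n M c f : boxsum n M (fun l => c * f l) = c * boxsum n M f.
Proof.
  revert f. induction n as [|n IH]; intros f; cbn [boxsum]; [reflexivity|].
  rewrite scal_sum. apply sum_eq. intros i _. rewrite IH. ring.
Qed.

Lemma pos_expect_S lam n M z g :
  pos_expect lam (S n) M z g
  = zsum M (fun y => incr_pmf lam (y - z) *
                     pos_expect lam n M y (fun l => g (y :: l))).
Proof.
  unfold pos_expect. cbn [boxsum].
  rewrite <- (sum_f_R0_zsum M (fun y => incr_pmf lam (y - z) *
     boxsum n M (fun l => path_prod lam y l * g (y :: l)))).
  apply sum_eq. intros i _. rewrite <- boxsum_scal.
  apply boxsum_ext. intros l _. cbn. ring.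
Qed.

(** * Comparison of the two truncations *)

Section Truncation.
Variable lam : R.
Hypothesis pmf_ge0 : forall k, 0 <= incr_pmf lam k.

Lemma incr_expect_le n M z g1 g2 :
  (forall l, length l = n -> g1 l <= g2 l) ->
  incr_expect lam n M z g1 <= incr_expect lam n M z g2.
Proof.
  revert z g1 g2. induction n as [|n IH]; intros z g1 g2 H; cbn [incr_expect];
    [now apply H|].
  apply zsum_le. intros k _. apply Rmult_le_compat_l; [apply pmf_ge0|].
  apply IH. intros l Hl. apply H. cbn. now rewrite Hl.
Qed.

Lemma incr_expect_ge0 n M z g :
  (forall l, 0 <= g l) -> 0 <= incr_expect lam n M z g.
Proof.
  revert z g. induction n as [|n IH]; intros z g H; cbn [incr_expect]; [apply H|].
  apply zsum_ge0. intros k. apply Rmult_le_pos; [apply pmf_ge0|now apply IH].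
Qed.

Lemma incr_expect_mono n M M' z g :
  (forall l, 0 <= g l) -> (M <= M')%nat ->
  incr_expect lam n M z g <= incr_expect lam n M' z g.
Proof.
  intros Hg HM. revert z g Hg. induction n as [|n IH]; intros z g Hg;
    cbn [incr_expect]; [lra|].
  eapply Rle_trans; [|apply (zsum_mono M M'); [|exact HM]].
  - apply zsum_le. intros k _. apply Rmult_le_compat_l; [apply pmf_ge0|].
    now apply IH.
  - intros k. apply Rmult_le_pos; [apply pmf_ge0|now apply incr_expect_ge0].
Qed.

Lemma pos_expect_ge0 n M z g : (forall l, 0 <= g l) -> 0 <= pos_expect lam n M z g.
Proof.
  revert z g. induction n as [|n IH]; intros z g H.
  - unfold pos_expect; cbn. rewrite Rmult_1_l. apply H.
  - rewrite pos_expect_S. apply zsum_ge0. intros k.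
    apply Rmult_le_pos; [apply pmf_ge0|now apply IH].
Qed.

(** Two positions in [[-M, M]] differ by at most [2 * M], so every term on the left occurs on the
    right. *)
Lemma pos_le_incr n M z g :
  (forall l, 0 <= g l) -> (Z.abs z <= Z.of_nat M)%Z ->
  pos_expect lam n M z g <= incr_expect lam n (2 * M) z g.
Proof.
  revert z g. induction n as [|n IH]; intros z g Hg Hz.
  - unfold pos_expect; cbn. lra.
  - rewrite pos_expect_S. cbn [incr_expect].
    eapply Rle_trans;
      [|apply (zsum_shift M (2 * M) (- z)
          (fun k => incr_pmf lam k * incr_expect lam n (2 * M) (z + k)
                                      (fun l => g ((z + k)%Z :: l)))); [|lia]].
    + apply zsum_le. intros y Hy.
      replace (y + - z)%Z with (y - z)%Z by lia.
      replace (z + (y - z))%Z with y by lia.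
      apply Rmult_le_compat_l; [apply pmf_ge0|]. now apply IH.
    + intros k. apply Rmult_le_pos; [apply pmf_ge0|now apply incr_expect_ge0].
Qed.

Lemma incr_le_pos n M M' z g :
  (forall l, 0 <= g l) ->
  (Z.abs z + Z.of_nat n * Z.of_nat M <= Z.of_nat M')%Z ->
  incr_expect lam n M z g <= pos_expect lam n M' z g.
Proof.
  revert z g. induction n as [|n IH]; intros z g Hg Hz.
  - unfold pos_expect; cbn. lra.
  - rewrite pos_expect_S. cbn [incr_expect].
    eapply Rle_trans;
      [|apply (zsum_shift M M' z
          (fun y => incr_pmf lam (y - z) * pos_expect lam n M' y
                                      (fun l => g (y :: l)))); [|nia]].
    + apply zsum_le. intros k Hk.
      replace (k + z - z)%Z with k by lia.
      replace (k + z)%Z with (z + k)%Z by lia.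
      apply Rmult_le_compat_l; [apply pmf_ge0|]. apply IH; [easy|nia].
    + intros k. apply Rmult_le_pos; [apply pmf_ge0|now apply pos_expect_ge0].
Qed.

(** A sandwich: at a large window the position sum lies between the increment sum at a fixed [N] and
    the one at [2 * M], which monotonicity keeps below [l]. *)
Lemma pos_expect_cv n z g l :
  (forall x, 0 <= g x) ->
  Un_cv (fun M => incr_expect lam n M z g) l ->
  Un_cv (fun M => pos_expect lam n M z g) l.
Proof.
  intros Hg Hl eps Heps. destruct (Hl eps Heps) as [N HN].
  assert (Hub : forall M, incr_expect lam n M z g <= l).
  { apply growing_ineq; [|exact Hl].
    intros M. apply incr_expect_mono; [exact Hg|lia]. }
  exists (Z.to_nat (Z.abs z + Z.of_nat n * Z.of_nat N)). intros M HM.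
  pose proof (incr_le_pos n N M z g Hg ltac:(lia)) as H1.
  pose proof (pos_le_incr n M z g Hg ltac:(lia)) as H2.
  pose proof (Hub (2 * M)%nat). specialize (HN N (le_n _)).
  unfold R_dist in *. apply Rabs_def2 in HN. apply Rabs_def1; lra.
Qed.

End Truncation.

Lemma obs_boxsum theta T Delta M g :
  boxsum (S (nobs T Delta)) M (fun x => obs_pmf theta T Delta x * g x)
  = pos_expect (theta * Delta) (nobs T Delta) M 0 (fun l => g (0%Z :: l)).
Proof.
  cbn [boxsum].
  rewrite (sum_f_R0_zsum M (fun y => boxsum (nobs T Delta) M
    (fun l => obs_pmf theta T Delta (y :: l) * g (y :: l)))).
  rewrite zsum_point.
  - apply boxsum_ext. intros l Hl. unfold obs_pmf.
    destruct (Z.eq_dec 0 0); [|easy].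
    destruct (Nat.eq_dec (length l) (nobs T Delta)); [reflexivity|easy].
  (* The zero is written as a product so that [boxsum_scal] can pull it out of the sum. *)
  - intros y Hy. rewrite (boxsum_ext _ _ _ (fun l => 0 * 0)).
    + rewrite boxsum_scal. ring.
    + intros l _. unfold obs_pmf. destruct (Z.eq_dec y 0); [easy|ring].
Qed.

(** * The simple random walk *)

Lemma rad_bounds m k : 0 <= rad_pmf m k <= 1.
Proof.
  revert k. induction m as [|m IH]; intros k; cbn [rad_pmf].
  - destruct (Z.eq_dec k 0); lra.
  - pose proof (IH (k - 1)%Z). pose proof (IH (k + 1)%Z). lra.
Qed.

Lemma rad_support m k : (Z.of_nat m < Z.abs k)%Z -> rad_pmf m k = 0.
Proof.
  revert k. induction m as [|m IH]; intros k H; cbn [rad_pmf].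
  - destruct (Z.eq_dec k 0); [lia|reflexivity].
  - rewrite !IH by lia. lra.
Qed.

Lemma rad_opp m k : rad_pmf m (- k) = rad_pmf m k.
Proof.
  revert k. induction m as [|m IH]; intros k; cbn [rad_pmf].
  - destruct (Z.eq_dec (- k) 0), (Z.eq_dec k 0); lia || reflexivity.
  - replace (- k - 1)%Z with (- (k + 1))%Z by lia.
    replace (- k + 1)%Z with (- (k - 1))%Z by lia.
    rewrite !IH. lra.
Qed.

Lemma rad_pos m : 0 < rad_pmf m (Z.of_nat m).
Proof.
  induction m as [|m IH]; cbn [rad_pmf]; [simpl; lra|].
  replace (Z.of_nat (S m) - 1)%Z with (Z.of_nat m) by lia.
  pose proof (rad_bounds m (Z.of_nat (S m) + 1)). lra.
Qed.

(** By exchangeability, [S_(m+1)] on the event [S_(m+1) = k] has [m + 1] times the expectation of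
    its first step there, and conditioning on that step gives the right side. Divided by [(m + 1)!]
    this is the three-term recurrence of the Bessel functions. *)
Lemma rad_recurrence m k :
  IZR k * rad_pmf (S m) k
  = INR (S m) / 2 * (rad_pmf m (k - 1) - rad_pmf m (k + 1)).
Proof.
  revert k. induction m as [|m IH]; intros k.
  - cbn. destruct (Z.eq_dec (k - 1) 0), (Z.eq_dec (k + 1) 0); try lia.
    + replace k with 1%Z by lia. lra.
    + replace k with (-1)%Z by lia. lra.
    + lra.
  - change (rad_pmf (S (S m)) k) with ((rad_pmf (S m) (k - 1) + rad_pmf (S m) (k + 1)) / 2).
    pose proof (IH (k - 1)%Z) as H1. pose proof (IH (k + 1)%Z) as H2.
    rewrite minus_IZR in H1. rewrite plus_IZR in H2.
    replace (k - 1 + 1)%Z with k in H1 by lia.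
    replace (k + 1 - 1)%Z with k in H2 by lia.
    assert (E1 : rad_pmf (S m) (k - 1) = (rad_pmf m (k - 1 - 1) + rad_pmf m k) / 2).
    { cbn [rad_pmf]. now replace (k - 1 + 1)%Z with k by lia. }
    assert (E2 : rad_pmf (S m) (k + 1) = (rad_pmf m k + rad_pmf m (k + 1 + 1)) / 2).
    { cbn [rad_pmf]. now replace (k + 1 - 1)%Z with k by lia. }
    rewrite (S_INR (S m)).
    nra.
Qed.

(** Conditioning on one step at a time needs no window, and moments follow by induction on [m]. *)
Fixpoint rad_expect (m : nat) (phi : Z -> R) : R :=
  match m with
  | O => phi 0%Z
  | S m' => (rad_expect m' (fun k => phi (k + 1)%Z)
             + rad_expect m' (fun k => phi (k - 1)%Z)) / 2
  end.

Lemma zsum_rad m M phi :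
  (m <= M)%nat -> zsum M (fun k => rad_pmf m k * phi k) = rad_expect m phi.
Proof.
  revert phi. induction m as [|m IH]; intros phi HM; cbn [rad_expect].
  - rewrite zsum_point; [simpl; lra|].
    intros k Hk. cbn. destruct (Z.eq_dec k 0); [easy|lra].
  - rewrite <- !IH by lia. cbn [rad_pmf].
    rewrite (zsum_ext M _ (fun k =>
      / 2 * ((fun j => rad_pmf m j * phi (j + 1)%Z) (k - 1)%Z
             + (fun j => rad_pmf m j * phi (j - 1)%Z) (k + 1)%Z))).
    + rewrite zsum_scal, zsum_plus.
      rewrite (zsum_pred M (fun j => rad_pmf m j * phi (j + 1)%Z)),
              (zsum_succ M (fun j => rad_pmf m j * phi (j - 1)%Z)).
      (* Here [S m <= M], so even the end points of the window lie outside the support of [m]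
         steps. *)
      cbv beta. rewrite !(rad_support m (- Z.of_nat M - 1)), !(rad_support m (Z.of_nat M)),
        !(rad_support m (Z.of_nat M + 1)), !(rad_support m (- Z.of_nat M)) by lia.
      lra.
    + intros k _. cbv beta.
      replace (k - 1 + 1)%Z with k by lia. replace (k + 1 - 1)%Z with k by lia. lra.
Qed.

Lemma rad_expect_ext m f g : (forall k, f k = g k) -> rad_expect m f = rad_expect m g.
Proof.
  revert f g. induction m as [|m IH]; intros f g H; cbn [rad_expect]; [apply H|].
  now rewrite (IH _ _ (fun k => H (k + 1)%Z)), (IH _ _ (fun k => H (k - 1)%Z)).
Qed.

Lemma rad_moment0 m : rad_expect m (fun _ => 1) = 1.
Proof. induction m as [|m IH]; cbn [rad_expect]; [|rewrite IH]; lra. Qed.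

Lemma rad_shift m (P : R -> R) z :
  rad_expect (S m) (fun k => P (z + IZR k))
  = (rad_expect m (fun k => P ((z + 1) + IZR k))
     + rad_expect m (fun k => P ((z - 1) + IZR k))) / 2.
Proof.
  cbn [rad_expect]. f_equal. f_equal; apply rad_expect_ext; intros k.
  - rewrite plus_IZR. f_equal. lra.
  - rewrite minus_IZR. f_equal. lra.
Qed.

(** The start [z] stays general here and in the higher moments, because one step of the walk moves
    it to [z + 1] or [z - 1]. *)
Lemma rad_moment2 m z : rad_expect m (fun k => (z + IZR k) ^ 2) = z ^ 2 + INR m.
Proof.
  revert z. induction m as [|m IH]; intros z; [cbn; ring|].
  rewrite (rad_shift m (fun x => x ^ 2)), !IH, S_INR. field.
Qed.

Lemma rad_moment4 m z :
  rad_expect m (fun k => (z + IZR k) ^ 4)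
  = z ^ 4 + 6 * z ^ 2 * INR m + 3 * INR m ^ 2 - 2 * INR m.
Proof.
  revert z. induction m as [|m IH]; intros z; [cbn; ring|].
  rewrite (rad_shift m (fun x => x ^ 4)), !IH, S_INR. field.
Qed.

Lemma rad_moment6 m z :
  rad_expect m (fun k => (z + IZR k) ^ 6)
  = z ^ 6 + 15 * z ^ 4 * INR m + 15 * z ^ 2 * (3 * INR m ^ 2 - 2 * INR m)
    + (15 * INR m ^ 3 - 30 * INR m ^ 2 + 16 * INR m).
Proof.
  revert z. induction m as [|m IH]; intros z; [cbn; ring|].
  rewrite (rad_shift m (fun x => x ^ 6)), !IH, S_INR. field.
Qed.

(** * Bessel functions and the Skellam law *)

Lemma is_series_Rscal (c : R) (a : nat -> R) (l : R) :
  is_series a l -> is_series (fun n => c * a n) (c * l).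
Proof. exact (is_series_scal c a l). Qed.

Lemma is_series_Rplus (a b : nat -> R) (la lb : R) :
  is_series a la -> is_series b lb -> is_series (fun n => a n + b n) (la + lb).
Proof. exact (is_series_plus a b la lb). Qed.

Lemma CV_radius_infinite (a : nat -> R) :
  (forall x, CV_disk a x) -> CV_radius a = p_infty.
Proof.
  intros H. destruct (CV_radius a) as [r| |] eqn:E; [|reflexivity|].
  - exfalso. apply (CV_disk_outside a (Rabs r + 1)).
    + rewrite E. cbn. pose proof (Rle_abs r). pose proof (Rle_abs (Rabs r + 1)). lra.
    + apply ex_series_lim_0, ex_series_Rabs, H.
  - exfalso. pose proof (CV_radius_ge_0 a) as H0. now rewrite E in H0.
Qed.

(* [bessel k] is the modified Bessel function [I_k]: the [m]-th moment of
   [cos t] against [cos (k t)] is the random walk probability [rad_pmf m k]. *)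
Definition bessel_coef (k : Z) (m : nat) : R := rad_pmf m k / INR (fact m).
Definition bessel (k : Z) (x : R) : R := PSeries (bessel_coef k) x.

Lemma bessel_coef_disk k x : CV_disk (bessel_coef k) x.
Proof.
  apply (@ex_series_le R_AbsRing R_CompleteNormedModule _
           (fun m => scal (pow_n (Rabs x) m) (/ INR (fact m)))).
  - intros m.
    change (Rabs (Rabs (bessel_coef k m * x ^ m))
            <= scal (pow_n (Rabs x) m) (/ INR (fact m))).
    rewrite Rabs_Rabsolu, Rabs_mult, <- RPow_abs.
    replace (pow_n (Rabs x) m) with (Rabs x ^ m) by (symmetry; apply pow_n_pow).
    change (scal (Rabs x ^ m) (/ INR (fact m))) with (Rabs x ^ m * / INR (fact m)).
    rewrite Rmult_comm. apply Rmult_le_compat_l; [apply pow_le, Rabs_pos|].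
    unfold bessel_coef. pose proof (INR_fact_lt_0 m) as Hf.
    pose proof (rad_bounds m k) as Hr.
    rewrite Rabs_pos_eq.
    + unfold Rdiv. rewrite <- (Rmult_1_l (/ INR (fact m))) at 2.
      apply Rmult_le_compat_r; [|lra]. now apply Rlt_le, Rinv_0_lt_compat.
    + apply Rmult_le_pos; [lra|]. now apply Rlt_le, Rinv_0_lt_compat.
  - exists (exp (Rabs x)). apply is_exp_Reals.
Qed.

Lemma bessel_radius k x : Rbar_lt (Rabs x) (CV_radius (bessel_coef k)).
Proof. rewrite CV_radius_infinite; [exact Logic.I|apply bessel_coef_disk]. Qed.

Lemma bessel_series k x :
  is_series (fun m => x ^ m / INR (fact m) * rad_pmf m k) (bessel k x).
Proof.
  apply (is_series_ext (fun m => scal (pow_n x m) (bessel_coef k m))).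
  - intros m.
    replace (pow_n x m) with (x ^ m) by (symmetry; apply pow_n_pow).
    change (scal (x ^ m) (bessel_coef k m)) with (x ^ m * bessel_coef k m).
    unfold bessel_coef, Rdiv. simpl. ring.
  - apply PSeries_correct, CV_disk_correct, bessel_coef_disk.
Qed.

(** Convergence is what gives the choice operator inside [incr_pmf] its intended value. *)
Lemma incr_pmf_series x k :
  is_series (fun m => exp (- x) * x ^ m / INR (fact m) * rad_pmf m k) (incr_pmf x k).
Proof.
  assert (H : is_series (fun m => exp (- x) * x ^ m / INR (fact m) * rad_pmf m k)
                (exp (- x) * bessel k x)).
  { apply (is_series_ext (fun m => scal (exp (- x)) (x ^ m / INR (fact m) * rad_pmf m k))).
    - intros m. change scal with Rmult. unfold Rdiv. simpl. ring.
    - exact (is_series_Rscal (exp (- x)) _ _ (bessel_series k x)). }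
  replace (incr_pmf x k) with (exp (- x) * bessel k x); [exact H|].
  symmetry. apply seq_lim_eq. apply is_series_Reals in H. exact H.
Qed.

Lemma incr_pmf_bessel x k : incr_pmf x k = exp (- x) * bessel k x.
Proof.
  rewrite <- (is_series_unique _ _ (incr_pmf_series x k)).
  rewrite <- (is_series_unique _ _ (bessel_series k x)), <- Series_scal_l.
  apply Series_ext. intros m. unfold Rdiv. simpl. ring.
Qed.

Lemma bessel_pos k x : 0 < x -> 0 < bessel k x.
Proof.
  assert (H : forall n, 0 < x -> 0 < bessel (Z.of_nat n) x).
  { intros n Hx. pose proof (bessel_series (Z.of_nat n) x) as H.
    apply is_series_Reals in H.
    assert (Ht : forall m, 0 <= x ^ m / INR (fact m) * rad_pmf m (Z.of_nat n)).
    { intros m. apply Rmult_le_pos; [|apply rad_bounds].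
      apply Rle_mult_inv_pos; [now apply pow_le, Rlt_le|apply INR_fact_lt_0]. }
    eapply Rlt_le_trans; [|apply (sum_incr _ n _ H Ht)].
    apply Rlt_le_trans with (x ^ n / INR (fact n) * rad_pmf n (Z.of_nat n)).
    - apply Rmult_lt_0_compat; [|apply rad_pos].
      apply Rdiv_lt_0_compat; [now apply pow_lt|apply INR_fact_lt_0].
    - destruct n as [|n]; [simpl; lra|].
      cbn [sum_f_R0].
      pose proof (cond_pos_sum (fun m => x ^ m / INR (fact m) *
        rad_pmf m (Z.of_nat (S n))) n Ht). lra. }
  intros Hx. destruct (Z_le_gt_dec 0 k) as [Hk|Hk].
  - rewrite <- (Z2Nat.id k Hk). now apply H.
  - replace (bessel k x) with (bessel (- k) x).
    + rewrite <- (Z2Nat.id (- k)) by lia. now apply H.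
    + apply PSeries_ext. intros m. unfold bessel_coef. now rewrite rad_opp.
Qed.

Lemma bessel_opp k x : bessel (- k) x = bessel k x.
Proof. apply PSeries_ext. intros m. unfold bessel_coef. now rewrite rad_opp. Qed.

Lemma incr_pmf_pos x k : 0 < x -> 0 < incr_pmf x k.
Proof.
  intros Hx. rewrite incr_pmf_bessel.
  apply Rmult_lt_0_compat; [apply exp_pos|now apply bessel_pos].
Qed.

Lemma PSeries_half_sum k x :
  PSeries (fun m => (bessel_coef (k - 1) m + bessel_coef (k + 1) m) / 2) x
  = (bessel (k - 1) x + bessel (k + 1) x) / 2.
Proof.
  transitivity (PSeries (PS_scal (/ 2)
    (PS_plus (bessel_coef (k - 1)) (bessel_coef (k + 1)))) x).
  - apply PSeries_ext. intros m. unfold PS_scal, PS_plus.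
    change scal with Rmult; change plus with Rplus. simpl. lra.
  - rewrite PSeries_scal, PSeries_plus by (apply CV_disk_correct, bessel_coef_disk).
    unfold bessel. lra.
Qed.

(** Differentiation shifts the coefficient index by one, and one more step of the walk averages over
    [k - 1] and [k + 1]. *)
Lemma bessel_heat k x :
  is_derive (bessel k) x ((bessel (k - 1) x + bessel (k + 1) x) / 2).
Proof.
  rewrite <- PSeries_half_sum.
  rewrite <- (PSeries_ext (PS_derive (bessel_coef k))).
  - apply is_derive_PSeries, bessel_radius.
  - intros m. unfold PS_derive, bessel_coef. cbn [rad_pmf].
    rewrite fact_simpl, mult_INR. pose proof (INR_fact_neq_0 m).
    pose proof (not_0_INR (S m) ltac:(lia)). field. now split.
Qed.

Lemma bessel_recurrence k x :
  IZR k * bessel k x = x / 2 * (bessel (k - 1) x - bessel (k + 1) x).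
Proof.
  unfold bessel. rewrite <- PSeries_scal.
  transitivity (x * PSeries (PS_scal (/ 2)
    (PS_minus (bessel_coef (k - 1)) (bessel_coef (k + 1)))) x).
  - rewrite <- PSeries_incr_1. apply PSeries_ext. intros m.
    unfold PS_scal, PS_incr_1, PS_minus, PS_plus, PS_opp, bessel_coef.
    change scal with Rmult; change plus with Rplus; change opp with Ropp.
    destruct m as [|m].
    + cbn. change zero with 0. destruct (Z.eq_dec k 0) as [->|]; lra.
    + pose proof (rad_recurrence m k) as H.
      rewrite fact_simpl, mult_INR. pose proof (INR_fact_neq_0 m).
      pose proof (not_0_INR (S m) ltac:(lia)) as HS.
      unfold Rdiv at 1. rewrite <- Rmult_assoc, H. field. now split.
  - rewrite PSeries_scal, PSeries_minus by (apply CV_disk_correct, bessel_coef_disk).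
    lra.
Qed.

(** The recurrence eliminates [bessel (k - 1)] from the logarithmic derivative, so a single ratio of
    consecutive Bessel functions carries the analysis. *)
Lemma incr_pmf_score k x :
  0 < x ->
  is_derive (fun y => ln (incr_pmf y k)) x
    (IZR k / x + bessel (k + 1) x / bessel k x - 1).
Proof.
  intros Hx. pose proof (bessel_pos k x Hx) as Hb.
  apply (is_derive_ext_loc (fun y => - y + ln (bessel k y))).
  - assert (Hloc : locally x (fun y => 0 < y)).
    { exists (mkposreal x Hx). intros y Hy.
      change (Rabs (y - x) < x) in Hy. apply Rabs_def2 in Hy. lra. }
    revert Hloc. apply filter_imp. intros y Hy.
    rewrite incr_pmf_bessel, ln_mult, ln_exp;
      [reflexivity|apply exp_pos|now apply bessel_pos].
  - auto_derive.
    + split; [|easy]. eexists. apply bessel_heat.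
    + replace (Derive (fun y => bessel k y) x)
        with ((bessel (k - 1) x + bessel (k + 1) x) / 2)
        by (symmetry; apply is_derive_unique, bessel_heat).
      pose proof (bessel_recurrence k x) as H.
      replace (bessel (k - 1) x) with (bessel (k + 1) x + 2 * IZR k / x * bessel k x).
      * field. split; lra.
      * apply (Rmult_eq_reg_l (x / 2)); [|lra].
        transitivity (x / 2 * bessel (k + 1) x + IZR k * bessel k x); [field; lra|].
        rewrite H. ring.
Qed.

(** * Bounds on ratios of consecutive Bessel functions *)

(** Together with [bessel_derive_down] this is a closed first-order system for orders [k] and
    [k + 1], which makes the derivative in [bessel_turan] computable. *)
Lemma bessel_derive_up k x :
  0 < x -> is_derive (bessel k) x (bessel (k + 1) x + IZR k / x * bessel k x).
Proof.
  intros Hx. pose proof (bessel_recurrence k x) as H.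
  replace (bessel (k + 1) x + IZR k / x * bessel k x)
    with ((bessel (k - 1) x + bessel (k + 1) x) / 2); [apply bessel_heat|].
  replace (IZR k / x * bessel k x) with ((IZR k * bessel k x) / x) by (field; lra).
  rewrite H. field. lra.
Qed.

Lemma bessel_derive_down k x :
  0 < x ->
  is_derive (bessel (k + 1)) x (bessel k x - (IZR k + 1) / x * bessel (k + 1) x).
Proof.
  intros Hx. pose proof (bessel_recurrence (k + 1) x) as H.
  pose proof (bessel_heat (k + 1) x) as Hd.
  replace (k + 1 - 1)%Z with k in * by lia. rewrite plus_IZR in H.
  replace (bessel k x - (IZR k + 1) / x * bessel (k + 1) x)
    with ((bessel k x + bessel (k + 1 + 1) x) / 2); [exact Hd|].
  replace ((IZR k + 1) / x * bessel (k + 1) x)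
    with (((IZR k + 1) * bessel (k + 1) x) / x) by (field; lra).
  rewrite H. field. lra.
Qed.

Lemma nondecreasing_of_derive (f df : R -> R) a b :
  a <= b -> (forall x, a <= x <= b -> is_derive f x (df x)) ->
  (forall x, a <= x <= b -> 0 <= df x) -> f a <= f b.
Proof.
  intros Hab Hd Hpos.
  destruct (MVT_gen f a b df) as [c [Hc Heq]];
    rewrite ?Rmin_left, ?Rmax_right in * by lra.
  - intros x Hx. apply Hd. lra.
  - intros x Hx. apply derivable_continuous_pt. exists (df x).
    apply is_derive_Reals, Hd, Hx.
  - pose proof (Hpos c Hc). nra.
Qed.

(* The derivative of [x (A^2 - B^2) - (2k+1) A B] with [A = I_k], [B = I_{k+1}]
   simplifies to [(2k+1) A B / x], which is nonnegative. *)
Lemma bessel_turan k x :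
  (0 <= k)%Z -> 0 < x ->
  0 <= x * (bessel k x ^ 2 - bessel (k + 1) x ^ 2)
       - (2 * IZR k + 1) * bessel k x * bessel (k + 1) x.
Proof.
  intros Hk Hx.
  set (H := fun y => y * (bessel k y ^ 2 - bessel (k + 1) y ^ 2)
                     - (2 * IZR k + 1) * bessel k y * bessel (k + 1) y).
  change (0 <= H x).
  assert (HkR : 0 <= IZR k) by now apply IZR_le.
  assert (Hd : forall y, 0 < y ->
    is_derive H y ((2 * IZR k + 1) / y * bessel k y * bessel (k + 1) y)).
  { intros y Hy. unfold H. auto_derive.
    - repeat split; trivial; eexists;
        (apply bessel_derive_up || apply bessel_derive_down); exact Hy.
    - replace (Derive (fun z => bessel k z) y)
        with (bessel (k + 1) y + IZR k / y * bessel k y)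
        by (symmetry; apply is_derive_unique, bessel_derive_up, Hy).
      replace (Derive (fun z => bessel (k + 1) z) y)
        with (bessel k y - (IZR k + 1) / y * bessel (k + 1) y)
        by (symmetry; apply is_derive_unique, bessel_derive_down, Hy).
      field. lra. }
  assert (Hmono : forall y, 0 < y <= x -> H y <= H x).
  { intros y Hy. apply nondecreasing_of_derive with
      (fun y => (2 * IZR k + 1) / y * bessel k y * bessel (k + 1) y).
    - lra.
    - intros z Hz. apply Hd. lra.
    - intros z Hz. pose proof (bessel_pos k z ltac:(lra)).
      pose proof (bessel_pos (k + 1) z ltac:(lra)).
      apply Rmult_le_pos; [|lra]. apply Rmult_le_pos; [|lra].
      apply Rlt_le, Rdiv_lt_0_compat; lra. }
  assert (Hb0 : forall j, bessel j 0 = rad_pmf 0 j).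
  { intros j. unfold bessel. rewrite PSeries_0. unfold bessel_coef. simpl. lra. }
  assert (H0 : H 0 = 0).
  { unfold H. rewrite !Hb0. cbn. destruct (Z.eq_dec (k + 1) 0); [lia|lra]. }
  (* The derivative formula is singular at [0], so monotonicity is available only for positive
     arguments; continuity at [0] carries the value [H 0 = 0] over as a lower bound. *)
  assert (Hc : continuity_pt H 0).
  { apply derivable_continuous_pt. unfold H.
    assert (Hb : forall j, derivable_pt (bessel j) 0).
    { intros j. eexists. apply is_derive_Reals, bessel_heat. }
    pose proof (Hb k). pose proof (Hb (k + 1)%Z).
    apply derivable_pt_minus.
    - apply derivable_pt_mult; [apply derivable_pt_id|].
      apply derivable_pt_minus;
        (apply (derivable_pt_comp _ (fun z => z ^ 2)); [easy|apply derivable_pt_pow]).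
    - apply derivable_pt_mult; [|easy].
      apply derivable_pt_mult; [apply derivable_pt_const|easy]. }
  destruct (Rle_lt_dec 0 (H x)) as [Hle|Hlt]; [exact Hle|exfalso].
  destruct (Hc (- H x)) as [d [Hd0 Hcd]]; [lra|].
  set (y := Rmin (d / 2) x).
  assert (Hy : 0 < y <= x /\ y < d).
  { unfold y. pose proof (Rmin_l (d / 2) x). pose proof (Rmin_r (d / 2) x).
    split; [split; [apply Rmin_pos|]|]; lra. }
  assert (Hlt' : R_dist (H y) (H 0) < - H x).
  { apply Hcd. split; [split; [exact Logic.I|lra]|].
    simpl. unfold R_dist. rewrite Rminus_0_r, Rabs_pos_eq; lra. }
  pose proof (Hmono y ltac:(lra)). unfold R_dist in Hlt'. rewrite H0 in Hlt'.
  apply Rabs_def2 in Hlt'. lra.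
Qed.

Definition score_rem (k : Z) (x : R) : R :=
  IZR k / x + bessel (k + 1) x / bessel k x - 1 + / (2 * x) - IZR k ^ 2 / (2 * x ^ 2).

(** Dividing [bessel_turan] by [x * bessel k x ^ 2] gives the quadratic inequality, hence
    [(r + a)^2 <= 1 + a^2 <= (1 + a^2 / 2)^2]. The half in [a] accounts for the term [/ (2 * x)] of
    [score_rem]. *)
Lemma ratio_upper k x (r := bessel (k + 1) x / bessel k x) (a := (IZR k + / 2) / x) :
  (0 <= k)%Z -> 0 < x -> 0 < r /\ r ^ 2 + 2 * a * r <= 1 /\ r + a <= 1 + a ^ 2 / 2.
Proof.
  intros Hk Hx. pose proof (bessel_turan k x Hk Hx) as H.
  pose proof (bessel_pos k x Hx) as HA. pose proof (bessel_pos (k + 1) x Hx) as HB.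
  assert (HkR : 0 <= IZR k) by now apply IZR_le.
  assert (Ha : 0 < a) by (apply Rdiv_lt_0_compat; lra).
  assert (Hr : 0 < r) by now apply Rdiv_lt_0_compat.
  assert (Hq : r ^ 2 + 2 * a * r <= 1).
  { apply (Rmult_le_reg_l (x * bessel k x ^ 2)).
    - apply Rmult_lt_0_compat; [exact Hx|now apply pow_lt].
    - replace (x * bessel k x ^ 2 * (r ^ 2 + 2 * a * r)) with
        (x * bessel (k + 1) x ^ 2 + (2 * IZR k + 1) * bessel k x * bessel (k + 1) x)
        by (unfold r, a; field; lra).
      lra. }
  repeat split; try assumption.
  apply Rsqr_incr_0_var; [|nra]. unfold Rsqr. pose proof (pow2_ge_0 (a ^ 2 / 2)). nra.
Qed.

Lemma ratio_step k x :
  0 < x -> bessel (k - 1) x / bessel k x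
           = bessel (k + 1) x / bessel k x + 2 * IZR k / x.
Proof.
  intros Hx. pose proof (bessel_recurrence k x) as H.
  pose proof (bessel_pos k x Hx).
  apply (Rmult_eq_reg_l (x / 2 * bessel k x)); [|nra].
  transitivity (x / 2 * bessel (k - 1) x); [field; lra|].
  transitivity (x / 2 * bessel (k + 1) x + IZR k * bessel k x); [|field; lra].
  rewrite H. ring.
Qed.

(** The upper bound is [ratio_upper] at [k]. For the lower one, [ratio_upper] at [k - 1] gives
    [(q - a)^2 >= 1 + a^2] for [q = bessel (k - 1) x / bessel k x] and [a = (k - 1/2) / x], and by
    [ratio_step] [q - a] equals [k / x + r + / (2 * x)]. *)
Lemma score_rem_bound_nonneg k x :
  (0 <= k)%Z -> 0 < x ->
  Rabs (score_rem k x) <= (2 + IZR k) / x ^ 2 + IZR k ^ 4 / x ^ 4.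
Proof.
  intros Hk Hx. unfold score_rem.
  assert (HkR : 0 <= IZR k) by now apply IZR_le.
  destruct (ratio_upper k x Hk Hx) as [Hr [_ Hup]].
  set (r := bessel (k + 1) x / bessel k x) in *.
  set (u := / x). assert (Hu : 0 < u) by now apply Rinv_0_lt_compat.
  assert (E1 : forall c, c / x = c * u) by reflexivity.
  assert (E2 : / (2 * x) = u / 2) by (unfold u; field; lra).
  assert (E3 : forall c, c / (2 * x ^ 2) = c * u ^ 2 / 2) by (intros; unfold u; field; lra).
  assert (E4 : forall c, c / x ^ 2 = c * u ^ 2) by (intros; unfold u; field; lra).
  assert (E5 : forall c, c / x ^ 4 = c * u ^ 4) by (intros; unfold u; field; lra).
  rewrite E2, E3, E4, E5. rewrite !E1 in *.
  assert (Hk4 : 0 <= IZR k ^ 4 * u ^ 4) by (apply Rmult_le_pos; apply pow_le; lra).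
  assert (Hu2 : 0 < u ^ 2) by nra.
  assert (Hku : 0 <= IZR k * u ^ 2) by nra.
  apply Rabs_le. split; [|nra].
  (* At [k = 0] the order [k - 1] is out of range for [ratio_upper], so the ratio of orders 1 and 0
     is bounded below through its reciprocal, which involves orders 2 and 1. *)
  destruct (Z.eq_dec k 0) as [->|Hk0].
  - destruct (ratio_upper 1 x ltac:(lia) Hx) as [Hr1 [_ Hup1]].
    pose proof (ratio_step 1 x Hx) as Hs.
    change (1 - 1)%Z with 0%Z in Hs. change (1 + 1)%Z with 2%Z in *.
    change (0 + 1)%Z with 1%Z in *.
    set (r1 := bessel 2 x / bessel 1 x) in *.
    pose proof (bessel_pos 0 x Hx). pose proof (bessel_pos 1 x Hx).
    assert (Hinv : r * (r1 + 2 * 1 / x) = 1).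
    { rewrite <- Hs. unfold r. field. lra. }
    rewrite !E1 in *.
    (* Here [a = 3 / 2 * u]: its half square is [9 / 8 * u ^ 2], and [2 * u - a] leaves [u / 2]. *)
    assert (Hq : r1 + 2 * 1 * u <= 1 + u / 2 + 9 / 8 * u ^ 2) by nra.
    assert (1 <= r * (1 + u / 2 + 9 / 8 * u ^ 2)) by nra.
    (* With [y = u / 2 + 9 / 8 * u ^ 2] this rests on [1 - y ^ 2 <= 1]. *)
    assert (1 - u / 2 - 9 / 8 * u ^ 2 <= r).
    { apply (Rmult_le_reg_r (1 + u / 2 + 9 / 8 * u ^ 2)); [nra|].
      pose proof (pow2_ge_0 (u / 2 + 9 / 8 * u ^ 2)). nra. }
    nra.
  - destruct (ratio_upper (k - 1) x ltac:(lia) Hx) as [Hr1 [Hq _]].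
    pose proof (ratio_step k x Hx) as Hs.
    pose proof (bessel_pos k x Hx). pose proof (bessel_pos (k - 1) x Hx).
    replace (k - 1 + 1)%Z with k in * by lia.
    set (r1 := bessel k x / bessel (k - 1) x) in *.
    fold r in Hs. set (q := bessel (k - 1) x / bessel k x) in *.
    assert (Hinv : q * r1 = 1) by (unfold q, r1; field; lra).
    rewrite minus_IZR in Hq. rewrite !E1 in *.
    set (a := (IZR k - 1 + / 2) * u) in *.
    assert (HkR1 : 1 <= IZR k) by (apply IZR_le; lia).
    assert (Ha : 0 < a) by (unfold a; nra).
    assert (Hq0 : 0 < q) by now apply Rdiv_lt_0_compat.
    assert (Hqq : 1 <= q * (q - 2 * a)).
    { assert (q ^ 2 * (r1 ^ 2 + 2 * a * r1) <= q ^ 2 * 1)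
        by (apply Rmult_le_compat_l; [apply pow2_ge_0|exact Hq]).
      replace (q ^ 2 * (r1 ^ 2 + 2 * a * r1))
        with ((q * r1) ^ 2 + 2 * a * q * (q * r1)) in H1 by ring.
      rewrite Hinv in H1. lra. }
    assert (Hqa : 0 < q - a).
    { assert (0 < q - 2 * a); [|lra].
      apply (Rmult_lt_reg_l q); [exact Hq0|]. lra. }
    (* A Taylor polynomial of [sqrt (1 + a^2)]: its square falls short of [1 + a^2] by
       [a^6 * (8 - a^2) / 64], and where the polynomial is positive one has [a^2 < 8]. *)
    assert (Hlow : 1 + a ^ 2 / 2 - a ^ 4 / 8 <= q - a).
    { destruct (Rle_lt_dec (1 + a ^ 2 / 2 - a ^ 4 / 8) 0) as [Hn|Hn]; [lra|].
      apply Rsqr_incr_0_var; [|lra]. unfold Rsqr.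
      apply Rle_trans with (1 + a ^ 2); [|nra].
      assert (0 <= a ^ 6 * (8 - a ^ 2)).
      { apply Rmult_le_pos; [apply pow_le; lra|]. nra. }
      nra. }
    assert (Ha4 : a ^ 4 <= IZR k ^ 4 * u ^ 4).
    { rewrite <- Rpow_mult_distr. apply pow_incr. unfold a. nra. }
    assert (Ha2 : a ^ 2 = IZR k ^ 2 * u ^ 2 - IZR k * u ^ 2 + u ^ 2 / 4)
      by (unfold a; field).
    assert (Hkr : IZR k * u + r - 1 + u / 2 = q - a - 1)
      by (unfold a; lra).
    rewrite Hkr. nra.
Qed.

(** * Log-likelihood of one increment and moments *)

Lemma incr_pmf_opp x k : incr_pmf x (- k) = incr_pmf x k.
Proof. now rewrite !incr_pmf_bessel, bessel_opp. Qed.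

(** This is [x] times the bound on [score_rem] at [x / 2], a lower bound for every parameter met
    when [Rabs h <= / 2]. *)
Definition rem_bound (x : R) (k : Z) : R :=
  (8 + 4 * Rabs (IZR k)) / x + 16 * IZR k ^ 4 / x ^ 3.

(** Up to a constant, [G] is the log of the Skellam weight relative to the centred Gaussian density
    of variance [z], so its derivative is [score_rem]. The mean value theorem is applied on a
    segment of length [Rabs h * x]. *)
Lemma log_ratio_nonneg k x h :
  (0 <= k)%Z -> 0 < x -> Rabs h <= / 2 ->
  Rabs (ln (incr_pmf (x * (1 + h)) k) - ln (incr_pmf x k)
        + ln (1 + h) / 2 - IZR k ^ 2 / x * (h / (1 + h)) / 2)
  <= Rabs h * rem_bound x k.
Proof.
  intros Hk Hx Hh. apply Rabs_le_between in Hh.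
  set (y := x * (1 + h)).
  set (G := fun z => ln (incr_pmf z k) + ln z / 2 + IZR k ^ 2 / (2 * z)).
  assert (Hy : 0 < y) by (apply Rmult_lt_0_compat; lra).
  assert (Hmin : x / 2 <= Rmin x y) by (apply Rmin_glb; unfold y; nra).
  assert (Hd : forall z, 0 < z -> is_derive G z (score_rem k z)).
  { intros z Hz. unfold G, score_rem.
    pose proof (incr_pmf_score k z Hz) as HL.
    set (L := fun w => ln (incr_pmf w k)) in HL.
    apply (is_derive_ext (fun w => L w + ln w / 2 + IZR k ^ 2 / (2 * w)));
      [reflexivity|].
    auto_derive.
    - repeat split; try lra. eexists. exact HL.
    - replace (Derive (fun w => L w) z)
        with (IZR k / z + bessel (k + 1) z / bessel k z - 1)
        by (symmetry; now apply is_derive_unique).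
      pose proof (bessel_pos k z Hz). field. lra. }
  destruct (MVT_gen G x y (score_rem k)) as [c [Hc Heq]].
  { intros z Hz. apply Hd. lra. }
  { intros z Hz. apply derivable_continuous_pt. exists (score_rem k z).
    apply is_derive_Reals, Hd. lra. }
  replace (ln (incr_pmf y k) - ln (incr_pmf x k)
        + ln (1 + h) / 2 - IZR k ^ 2 / x * (h / (1 + h)) / 2) with (G y - G x).
  2:{ unfold G, y. rewrite ln_mult by lra. field. lra. }
  rewrite Heq.
  replace (y - x) with (h * x) by (unfold y; ring).
  rewrite Rabs_mult, (Rabs_mult h x), (Rabs_pos_eq x) by lra.
  rewrite Rmult_comm, Rmult_assoc. apply Rmult_le_compat_l; [apply Rabs_pos|].
  assert (HkR : 0 <= IZR k) by now apply IZR_le.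
  assert (Hc0 : x / 2 <= c) by lra.
  assert (Hi : 0 < / c <= 2 * / x).
  { split; [apply Rinv_0_lt_compat; lra|].
    replace (2 * / x) with (/ (x / 2)) by (field; lra).
    apply Rinv_le_contravar; lra. }
  apply Rle_trans with (x * ((2 + IZR k) / c ^ 2 + IZR k ^ 4 / c ^ 4)).
  - apply Rmult_le_compat_l; [lra|]. apply score_rem_bound_nonneg; [exact Hk|lra].
  - unfold rem_bound. rewrite (Rabs_pos_eq (IZR k)) by exact HkR.
    replace ((8 + 4 * IZR k) / x + 16 * IZR k ^ 4 / x ^ 3)
      with (x * ((2 + IZR k) * (2 * / x) ^ 2 + IZR k ^ 4 * (2 * / x) ^ 4)) by (field; lra).
    apply Rmult_le_compat_l; [lra|]. unfold Rdiv. rewrite <- !pow_inv.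
    apply Rplus_le_compat; apply Rmult_le_compat_l;
      try (apply pow_incr; lra); [lra|now apply pow_le].
Qed.

Lemma log_ratio k x h :
  0 < x -> Rabs h <= / 2 ->
  Rabs (ln (incr_pmf (x * (1 + h)) k) - ln (incr_pmf x k)
        + ln (1 + h) / 2 - IZR k ^ 2 / x * (h / (1 + h)) / 2)
  <= Rabs h * rem_bound x k.
Proof.
  intros Hx Hh. destruct (Z_le_gt_dec 0 k) as [Hk|Hk].
  - now apply log_ratio_nonneg.
  - pose proof (log_ratio_nonneg (- k) x h ltac:(lia) Hx Hh) as H.
    unfold rem_bound in *.
    rewrite !incr_pmf_opp, opp_IZR, Rabs_Ropp in H.
    replace ((- IZR k) ^ 2) with (IZR k ^ 2) in H by ring.
    replace ((- IZR k) ^ 4) with (IZR k ^ 4) in H by ring. exact H.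
Qed.

(** * Skellam moments from Poisson factorial moments *)

(** The Poisson identity [E[N c(N)] = x E[c(N + 1)]], without the factor [exp (- x)]; iteration
    yields the factorial moments. *)
Lemma poisson_factorial_step x (c : nat -> R) (s : R) :
  is_series (fun m => x ^ m / INR (fact m) * c (S m)) s ->
  is_series (fun m => x ^ m / INR (fact m) * (INR m * c m)) (x * s).
Proof.
  intros H. apply is_series_decr_1.
  match goal with |- is_series _ ?l => replace l with (x * s) end.
  2:{ change (x * s = x * s + - (x ^ 0 / INR (fact 0) * (INR 0 * c 0%nat))).
      simpl. lra. }
  apply (is_series_ext (fun m => scal x (x ^ m / INR (fact m) * c (S m)))).
  - intros m. change scal with Rmult. rewrite fact_simpl, mult_INR.
    pose proof (INR_fact_neq_0 m). pose proof (not_0_INR (S m) ltac:(lia)).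
    change (x ^ S m) with (x * x ^ m). simpl (@eq _ _). field. now split.
  - apply (is_series_Rscal _ _ _ H).
Qed.

Lemma poisson_mass x : is_series (fun m => x ^ m / INR (fact m) * 1) (exp x).
Proof.
  apply (is_series_ext (fun m => scal (pow_n x m) (/ INR (fact m)))).
  - intros m. replace (pow_n x m) with (x ^ m) by (symmetry; apply pow_n_pow).
    change scal with Rmult. simpl. unfold Rdiv. ring.
  - apply is_exp_Reals.
Qed.

Lemma poisson_fact1 x :
  is_series (fun m => x ^ m / INR (fact m) * (INR m * 1)) (x * exp x).
Proof. apply (poisson_factorial_step x (fun _ => 1)), poisson_mass. Qed.

Lemma poisson_fact2 x :
  is_series (fun m => x ^ m / INR (fact m) * (INR m * (INR m - 1))) (x * (x * exp x)).
Proof.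
  apply (poisson_factorial_step x (fun m => INR m - 1)).
  eapply is_series_ext; [|apply poisson_fact1]. intros m. rewrite S_INR. simpl. ring.
Qed.

Lemma poisson_fact3 x :
  is_series (fun m => x ^ m / INR (fact m) * (INR m * ((INR m - 1) * (INR m - 2))))
    (x * (x * (x * exp x))).
Proof.
  apply (poisson_factorial_step x (fun m => (INR m - 1) * (INR m - 2))).
  eapply is_series_ext; [|apply poisson_fact2]. intros m. rewrite S_INR. simpl. ring.
Qed.

Lemma zsum_series (c : nat -> R) (a : nat -> Z -> R) (p phi : Z -> R) M :
  (forall k, is_series (fun m => c m * a m k) (p k)) ->
  is_series (fun m => c m * zsum M (fun k => a m k * phi k))
    (zsum M (fun k => p k * phi k)).
Proof.
  intros H.
  assert (H1 : forall k, is_series (fun m => c m * (a m k * phi k)) (p k * phi k)).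
  { intros k. rewrite (Rmult_comm (p k)).
    eapply is_series_ext;
      [|exact (is_series_Rscal (phi k) _ _ (H k))].
    intros m. change scal with Rmult. simpl. ring. }
  induction M as [|M IH]; cbn [zsum]; [apply H1|].
  eapply is_series_ext;
    [|apply is_series_Rplus;
      [apply is_series_Rplus; [apply IH|apply H1]
      |apply H1]].
  intros m. change plus with Rplus. simpl. ring.
Qed.

(** Conditioning on the number of jumps. From above, a window only loses mass from [rad_expect].
    From below, with at most [M] jumps the window [M] loses nothing, so the truncated moment
    dominates the partial sum of index [M]. The only exchange of summations is with a finite sum. *)
Lemma skellam_moment x (phi : Z -> R) V :
  0 < x -> (forall k, 0 <= phi k) ->
  is_series (fun m => x ^ m / INR (fact m) * rad_expect m phi) (V * exp x) ->
  (forall M, zsum M (fun k => incr_pmf x k * phi k) <= V) /\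
  Un_cv (fun M => zsum M (fun k => incr_pmf x k * phi k)) V.
Proof.
  intros Hx Hphi HV.
  set (w := fun m => exp (- x) * x ^ m / INR (fact m)).
  assert (Hw : forall m, 0 <= w m).
  { intros m. unfold w. apply Rle_mult_inv_pos; [|apply INR_fact_lt_0].
    apply Rmult_le_pos; [apply Rlt_le, exp_pos|now apply pow_le, Rlt_le]. }
  assert (Hser : is_series (fun m => w m * rad_expect m phi) V).
  { replace V with (exp (- x) * (V * exp x)).
    - eapply is_series_ext;
        [|exact (is_series_Rscal (exp (- x)) _ _ HV)].
      intros m. change scal with Rmult. unfold w, Rdiv. simpl. ring.
    - rewrite exp_Ropp. pose proof (exp_pos x). field. lra. }
  assert (HM : forall M, is_series (fun m => w m * zsum M (fun k => rad_pmf m k * phi k))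
      (zsum M (fun k => incr_pmf x k * phi k))).
  { intros M. apply zsum_series. intros k. apply incr_pmf_series. }
  assert (Hr : forall m k, 0 <= rad_pmf m k * phi k).
  { intros m k. apply Rmult_le_pos; [apply rad_bounds|apply Hphi]. }
  assert (Hub : forall M, zsum M (fun k => incr_pmf x k * phi k) <= V).
  { intros M.
    rewrite <- (is_series_unique _ _ (HM M)), <- (is_series_unique _ _ Hser).
    apply Series_le; [|now exists V]. intros m. split.
    - apply Rmult_le_pos; [apply Hw|apply zsum_ge0, Hr].
    - apply Rmult_le_compat_l; [apply Hw|].
      rewrite <- (zsum_rad m (M + m)) by lia. apply zsum_mono; [apply Hr|lia]. }
  split; [exact Hub|].
  intros eps Heps. apply is_series_Reals in Hser.
  destruct (Hser eps Heps) as [N HN]. exists N. intros M HMN.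
  specialize (HN M HMN). pose proof (Hub M) as HubM.
  assert (Hlow : sum_f_R0 (fun m => w m * rad_expect m phi) M
                 <= zsum M (fun k => incr_pmf x k * phi k)).
  { rewrite (sum_eq _ (fun m => w m * zsum M (fun k => rad_pmf m k * phi k))).
    - apply (sum_incr _ M); [apply is_series_Reals, HM|].
      intros m. apply Rmult_le_pos; [apply Hw|apply zsum_ge0, Hr].
    - intros i Hi. now rewrite zsum_rad by exact Hi. }
  unfold R_dist in *. apply Rabs_def2 in HN. apply Rabs_def1; lra.
Qed.

Lemma is_series_lin3 (u v w : nat -> R) a b c lu lv lw :
  is_series u lu -> is_series v lv -> is_series w lw ->
  is_series (fun m => a * u m + b * v m + c * w m) (a * lu + b * lv + c * lw).
Proof.
  intros Hu Hv Hw.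
  apply is_series_Rplus;
    [apply is_series_Rplus|];
    now apply is_series_Rscal.
Qed.

Section Moments.
Variable x : R.
Hypothesis Hx : 0 < x.

Lemma skellam_moment0 :
  (forall M, zsum M (fun k => incr_pmf x k * 1) <= 1) /\
  Un_cv (fun M => zsum M (fun k => incr_pmf x k * 1)) 1.
Proof.
  apply (skellam_moment x (fun _ => 1)); [exact Hx|intros; apply Rle_0_1|].
  rewrite Rmult_1_l. eapply is_series_ext; [|apply poisson_mass].
  intros m. now rewrite rad_moment0.
Qed.

Lemma skellam_moment2 :
  (forall M, zsum M (fun k => incr_pmf x k * IZR k ^ 2) <= x) /\
  Un_cv (fun M => zsum M (fun k => incr_pmf x k * IZR k ^ 2)) x.
Proof.
  apply (skellam_moment x (fun k => IZR k ^ 2)); [exact Hx|intros; apply pow2_ge_0|].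
  eapply is_series_ext; [|apply poisson_fact1].
  intros m. rewrite (rad_expect_ext m _ (fun k => (0 + IZR k) ^ 2))
    by (intros; now rewrite Rplus_0_l).
  rewrite rad_moment2. simpl. ring.
Qed.

Lemma skellam_moment4 :
  (forall M, zsum M (fun k => incr_pmf x k * IZR k ^ 4) <= 3 * x ^ 2 + x) /\
  Un_cv (fun M => zsum M (fun k => incr_pmf x k * IZR k ^ 4)) (3 * x ^ 2 + x).
Proof.
  apply (skellam_moment x (fun k => IZR k ^ 4));
    [exact Hx|intros k; replace (IZR k ^ 4) with ((IZR k ^ 2) ^ 2) by ring; apply pow2_ge_0|].
  (* In falling factorials, [3 m^2 - 2 m] is [3 m (m - 1) + m]. *)
  pose proof (is_series_lin3 _ _ _ 3 1 0 _ _ _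
    (poisson_fact2 x) (poisson_fact1 x) (poisson_mass x)) as H.
  replace ((3 * x ^ 2 + x) * exp x)
    with (3 * (x * (x * exp x)) + 1 * (x * exp x) + 0 * exp x) by ring.
  eapply is_series_ext; [|exact H].
  intros m. rewrite (rad_expect_ext m _ (fun k => (0 + IZR k) ^ 4))
    by (intros; now rewrite Rplus_0_l).
  rewrite rad_moment4. simpl. ring.
Qed.

Lemma skellam_moment6 M :
  zsum M (fun k => incr_pmf x k * IZR k ^ 6) <= 15 * x ^ 3 + 15 * x ^ 2 + x.
Proof.
  apply (skellam_moment x (fun k => IZR k ^ 6));
    [exact Hx|intros k; replace (IZR k ^ 6) with ((IZR k ^ 3) ^ 2) by ring; apply pow2_ge_0|].
  (* In falling factorials, [15 m^3 - 30 m^2 + 16 m] has coefficients 15, 15 and 1. *)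
  pose proof (is_series_lin3 _ _ _ 15 15 1 _ _ _
    (poisson_fact3 x) (poisson_fact2 x) (poisson_fact1 x)) as H.
  replace ((15 * x ^ 3 + 15 * x ^ 2 + x) * exp x)
    with (15 * (x * (x * (x * exp x))) + 15 * (x * (x * exp x)) + 1 * (x * exp x)) by ring.
  eapply is_series_ext; [|exact H].
  intros m. rewrite (rad_expect_ext m _ (fun k => (0 + IZR k) ^ 6))
    by (intros; now rewrite Rplus_0_l).
  rewrite rad_moment6. simpl. ring.
Qed.

End Moments.

(** * The normal distribution function *)

Lemma ex_derive_R_continuous (f : R -> R) x : ex_derive f x -> continuous f x.
Proof. exact (ex_derive_continuous f x). Qed.

Lemma sqrt_2PI_pos : 0 < sqrt (2 * PI).
Proof. apply sqrt_lt_R0. pose proof PI_RGT_0. lra. Qed.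

Lemma gauss_pos t : 0 < gauss t.
Proof. apply Rdiv_lt_0_compat; [apply exp_pos|apply sqrt_2PI_pos]. Qed.

Lemma gauss_opp t : gauss (- t) = gauss t.
Proof. unfold gauss. now replace ((- t) ^ 2) with (t ^ 2) by ring. Qed.

Lemma gauss_le_1 t : gauss t <= 1.
Proof.
  unfold gauss. apply Rle_trans with (1 / 1); [|lra].
  unfold Rdiv. apply Rmult_le_compat.
  - apply Rlt_le, exp_pos.
  - apply Rlt_le, Rinv_0_lt_compat, sqrt_2PI_pos.
  - rewrite <- exp_0. pose proof (pow2_ge_0 t) as H.
    destruct (Rle_lt_or_eq_dec 0 (t ^ 2) H) as [H1|H1].
    + apply Rlt_le, exp_increasing. lra.
    + rewrite <- H1. right. f_equal. lra.
  - apply Rinv_le_contravar; [lra|]. rewrite <- sqrt_1 at 1. apply sqrt_le_1_alt.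
    pose proof PI2_1. unfold PI2 in *. lra.
Qed.

Lemma gauss_derive t : is_derive gauss t (- t * gauss t).
Proof.
  unfold gauss. pose proof sqrt_2PI_pos.
  auto_derive; [easy|]. simpl. unfold Rdiv. field. lra.
Qed.

Lemma gauss_continuous t : continuous gauss t.
Proof. apply ex_derive_R_continuous. eexists. apply gauss_derive. Qed.

Section NormalCdf.
Variable Phi : R -> R.
Hypothesis HPhi : is_std_normal_cdf Phi.

Lemma cdf_derive t : is_derive Phi t (gauss t).
Proof. apply is_derive_Reals, HPhi. Qed.

Lemma cdf_mono a b : a <= b -> Phi a <= Phi b.
Proof.
  intros H. apply (nondecreasing_of_derive Phi gauss); [exact H| |].
  - intros; apply cdf_derive.
  - intros; apply Rlt_le, gauss_pos.
Qed.

Lemma cdf_ge0 t : 0 <= Phi t.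
Proof.
  apply Rnot_lt_le. intros H.
  destruct (proj2 HPhi (- Phi t)) as [A HA]; [lra|].
  pose proof (HA (Rmin A t) (Rmin_l _ _)) as H1.
  pose proof (cdf_mono _ _ (Rmin_r A t)). apply Rabs_def2 in H1. lra.
Qed.

(** The characterisation of [Phi] fixes its limit only at minus infinity; that the total mass is one
    has to come from the Gaussian integral, here evaluated by differentiating a parameter integral
    with this integrand. *)
Definition polar (x t : R) : R := exp (- (x ^ 2 * (1 + t ^ 2) / 2)) / (1 + t ^ 2).

Lemma polar_derive x t :
  is_derive (fun z => polar z t) x (- x * exp (- (x ^ 2 * (1 + t ^ 2) / 2))).
Proof.
  unfold polar. pose proof (pow2_ge_0 t).
  auto_derive; [nra|]. simpl. unfold Rdiv. field. nra.
Qed.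

Lemma polar_continuous x t : continuous (polar x) t.
Proof.
  apply ex_derive_R_continuous. unfold polar. pose proof (pow2_ge_0 t).
  auto_derive. repeat split; nra.
Qed.

Lemma polar_RInt_derive x :
  is_derive (fun z => RInt (polar z) 0 1) x
    (RInt (fun t => - x * exp (- (x ^ 2 * (1 + t ^ 2) / 2))) 0 1).
Proof.
  rewrite (RInt_ext _ (fun t => Derive (fun z => polar z t) x)).
  2:{ intros t _. symmetry. apply is_derive_unique, polar_derive. }
  apply (is_derive_RInt_param polar 0 1 x).
  - apply filter_forall. intros y t _. eexists. apply polar_derive.
  - intros t _.
    apply (continuity_2d_pt_ext
      (fun u v => (- u) * exp (- (u ^ 2 * (1 + v ^ 2) / 2)))).
    { intros u v. symmetry. apply is_derive_unique, polar_derive. }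
    assert (H1 : continuity_2d_pt (fun u _ => u) x t)
      by (apply continuity_2d_pt_id1).
    assert (H2 : continuity_2d_pt (fun _ v => v) x t)
      by (apply continuity_2d_pt_id2).
    apply continuity_2d_pt_mult; [now apply continuity_2d_pt_opp|].
    apply (continuity_1d_2d_pt_comp exp).
    + apply derivable_continuous_pt, derivable_pt_exp.
    + apply continuity_2d_pt_opp.
      apply (continuity_2d_pt_ext (fun u v => (u * u) * ((1 + v * v) * / 2))).
      { intros; field. }
      repeat (apply continuity_2d_pt_mult || apply continuity_2d_pt_plus
              || apply continuity_2d_pt_const || assumption).
  - apply filter_forall. intros y. apply (@ex_RInt_continuous R_CompleteNormedModule).
    intros t _. apply polar_continuous.
Qed.

(** Rescaling to the fixed interval [[0, 1]] gives the Gaussian primitive the shape of the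
    derivative in [polar_RInt_derive]. *)
Lemma cdf_increment x :
  is_RInt (fun t => x * gauss (x * t)) 0 1 (Phi x - Phi 0).
Proof.
  replace (Phi x - Phi 0) with (minus (Phi (x * 1)) (Phi (x * 0))).
  2:{ change (Phi (x * 1) - Phi (x * 0) = Phi x - Phi 0).
      now rewrite Rmult_1_r, Rmult_0_r. }
  apply (is_RInt_derive (fun t => Phi (x * t))).
  - intros t _. pose proof (cdf_derive (x * t)) as H.
    auto_derive; [eexists; exact H|].
    replace (Derive (fun y => Phi y) (x * t)) with (gauss (x * t))
      by (symmetry; now apply is_derive_unique). ring.
  - intros t _. apply ex_derive_R_continuous.
    auto_derive. eexists. apply gauss_derive.
Qed.

(* The squared Gaussian integral plus [RInt (polar x) 0 1 / PI] is constant in [x]. *)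
Lemma cdf_polar x : (Phi x - Phi 0) ^ 2 + RInt (polar x) 0 1 / PI = / 4.
Proof.
  pose proof PI_RGT_0 as HPI. pose proof sqrt_2PI_pos as Hs.
  assert (Hss : sqrt (2 * PI) * sqrt (2 * PI) = 2 * PI) by (apply sqrt_sqrt; lra).
  set (F := fun z => (Phi z - Phi 0) ^ 2 + RInt (polar z) 0 1 / PI).
  assert (Hd : forall z, is_derive F z 0).
  { intros z.
    assert (Hint : RInt (fun t => - z * exp (- (z ^ 2 * (1 + t ^ 2) / 2))) 0 1
                   = - (2 * PI * gauss z * (Phi z - Phi 0))).
    { apply is_RInt_unique.
      replace (- (2 * PI * gauss z * (Phi z - Phi 0)))
        with (scal (- (2 * PI * gauss z)) (Phi z - Phi 0))
        by (change scal with Rmult; simpl; ring).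
      eapply is_RInt_ext; [|apply (@is_RInt_scal R_NormedModule), cdf_increment].
      intros t _. change scal with Rmult. unfold gauss.
      replace (- (z ^ 2 * (1 + t ^ 2) / 2)) with (- z ^ 2 / 2 + - (z * t) ^ 2 / 2) by field.
      rewrite exp_plus.
      transitivity (- (2 * PI) * (exp (- z ^ 2 / 2) * z * exp (- (z * t) ^ 2 / 2))
                    / (sqrt (2 * PI) * sqrt (2 * PI))); [simpl; field; lra|].
      rewrite Hss. simpl. field. lra. }
    pose proof (cdf_derive z) as H1. pose proof (polar_RInt_derive z) as H2.
    rewrite Hint in H2.
    set (P := fun y => RInt (polar y) 0 1) in H2.
    apply (is_derive_ext (fun y => (Phi y - Phi 0) ^ 2 + P y / PI)); [reflexivity|].
    auto_derive.
    - repeat split; eexists; [exact H1|exact H2].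
    - replace (Derive (fun y => Phi y) z) with (gauss z)
        by (symmetry; now apply is_derive_unique).
      replace (Derive (fun y => P y) z) with (- (2 * PI * gauss z * (Phi z - Phi 0)))
        by (symmetry; now apply is_derive_unique).
      field. lra. }
  (* At [0] the integrand is the derivative of [atan], so the constant is [PI / 4] divided by
     [PI]. *)
  assert (H0 : F 0 = / 4).
  { unfold F. replace (RInt (polar 0) 0 1) with (PI / 4); [field; lra|].
    symmetry. apply is_RInt_unique.
    replace (PI / 4) with (minus (atan 1) (atan 0)).
    2:{ change (atan 1 - atan 0 = PI / 4). rewrite atan_0, atan_1. lra. }
    apply (is_RInt_derive atan).
    - intros t _. unfold polar.
      replace (- (0 ^ 2 * (1 + t ^ 2) / 2)) with 0 by field.
      rewrite exp_0. apply is_derive_Reals.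
      unfold Rdiv. rewrite Rmult_1_l.
      apply derivable_pt_lim_atan.
    - intros t _. apply polar_continuous. }
  change (F x = / 4). rewrite <- H0.
  destruct (MVT_gen F 0 x (fun _ => 0)) as [c [_ Hc]].
  - intros; apply Hd.
  - intros y _. apply derivable_continuous_pt. exists 0. apply is_derive_Reals, Hd.
  - lra.
Qed.

(** As the argument of [cdf_polar] goes to minus infinity, [Phi] and the integral both vanish, which
    leaves [Phi 0 ^ 2 = / 4]. *)
Lemma cdf_0 : Phi 0 = / 2.
Proof.
  pose proof PI_RGT_0 as HPI. pose proof PI2_1 as HPI2. unfold PI2 in HPI2.
  pose proof (cdf_ge0 0) as H0.
  assert (Hb : forall x, 0 <= RInt (polar x) 0 1 <= exp (- (x ^ 2 / 2))).
  { intros x.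
    assert (Hex : ex_RInt (polar x) 0 1).
    { apply (@ex_RInt_continuous R_CompleteNormedModule).
      intros t _. apply polar_continuous. }
    split.
    - apply RInt_ge_0; [lra|exact Hex|]. intros t _. unfold polar.
      apply Rlt_le, Rdiv_lt_0_compat; [apply exp_pos|]. pose proof (pow2_ge_0 t). lra.
    - replace (exp (- (x ^ 2 / 2))) with (RInt (fun _ => exp (- (x ^ 2 / 2))) 0 1).
      + apply RInt_le; [lra|exact Hex|apply ex_RInt_const|].
        intros t _. unfold polar. pose proof (pow2_ge_0 t).
        apply Rle_trans with (exp (- (x ^ 2 * (1 + t ^ 2) / 2)) / 1).
        * apply Rmult_le_compat_l; [apply Rlt_le, exp_pos|].
          apply Rinv_le_contravar; lra.
        * unfold Rdiv at 1. rewrite Rinv_1, Rmult_1_r.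
          pose proof (pow2_ge_0 (x * t)).
          destruct (Req_dec ((x * t) ^ 2) 0) as [E|E].
          { right. f_equal. nra. }
          apply Rlt_le, exp_increasing. nra.
      + rewrite RInt_const. change scal with Rmult. simpl. ring. }
  assert (Hsq : Phi 0 ^ 2 = / 4).
  { apply cond_eq. intros eps Heps.
    (* By [cdf_polar], [Phi 0 ^ 2 - / 4] is [2 * Phi x * Phi 0 - Phi x ^ 2 - K] with [K] the
       integral over [PI]; when [Phi x] and [K] are at most [e <= 1], its size is below
       [e * (4 + 2 * Phi 0)]. *)
    set (e := Rmin 1 (eps / (4 + 2 * Phi 0))).
    assert (He : 0 < e) by (apply Rmin_pos; [lra|apply Rdiv_lt_0_compat; lra]).
    assert (Hee : e <= 1 /\ e * (4 + 2 * Phi 0) <= eps).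
    { split; [apply Rmin_l|].
      apply Rle_trans with (eps / (4 + 2 * Phi 0) * (4 + 2 * Phi 0)).
      - apply Rmult_le_compat_r; [lra|apply Rmin_r].
      - right. field. lra. }
    destruct (proj2 HPhi e He) as [A HA].
    set (x := Rmin A (- (1 + 2 / e))).
    assert (Hx : x <= - (1 + 2 / e)) by apply Rmin_r.
    pose proof (HA x (Rmin_l _ _)) as HPx. apply Rabs_def2 in HPx.
    pose proof (cdf_ge0 x) as HPx0.
    pose proof (cdf_polar x) as Hp. pose proof (Hb x) as Hbx.
    assert (Hexp : exp (- (x ^ 2 / 2)) <= e).
    { rewrite exp_Ropp. rewrite <- (Rinv_inv e). apply Rinv_le_contravar.
      - now apply Rinv_0_lt_compat.
      - apply Rle_trans with (1 + x ^ 2 / 2); [|apply exp_ineq1_le].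
        assert (0 < 2 / e) by (apply Rdiv_lt_0_compat; lra).
        assert (/ e = (2 / e) / 2) by (field; lra). nra. }
    assert (HK : 0 <= RInt (polar x) 0 1 / PI <= e).
    { split.
      - apply Rmult_le_pos; [lra|]. apply Rlt_le, Rinv_0_lt_compat, HPI.
      - apply (Rmult_le_reg_r PI); [exact HPI|].
        unfold Rdiv. rewrite Rmult_assoc, Rinv_l, Rmult_1_r by lra. nra. }
    apply Rabs_def1; nra. }
  nra.
Qed.

Lemma cdf_sym x : Phi x + Phi (- x) = 1.
Proof.
  assert (Hd : forall z, is_derive (fun y => Phi y + Phi (- y)) z 0).
  { intros z. pose proof (cdf_derive z) as H1. pose proof (cdf_derive (- z)) as H2.
    auto_derive.
    - repeat split; eexists; [exact H1|exact H2].
    - replace (Derive (fun y => Phi y) z) with (gauss z)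
        by (symmetry; now apply is_derive_unique).
      replace (Derive (fun y => Phi y) (- z)) with (gauss (- z))
        by (symmetry; now apply is_derive_unique).
      rewrite gauss_opp. ring. }
  destruct (MVT_gen (fun y => Phi y + Phi (- y)) 0 x (fun _ => 0)) as [c [_ Hc]].
  - intros; apply Hd.
  - intros y _. apply derivable_continuous_pt. exists 0. apply is_derive_Reals, Hd.
  - rewrite Ropp_0, cdf_0 in Hc. lra.
Qed.

Lemma cdf_le1 x : Phi x <= 1.
Proof. pose proof (cdf_sym x). pose proof (cdf_ge0 (- x)). lra. Qed.

(** The Mills ratio of the left tail. Away from the ramp the Stein solution is a multiple of it,
    with [cdf_sym] reducing the right tail to the left one. *)
Definition mills (x : R) : R := Phi x / gauss x.

(** The defect [D] is nondecreasing, so a negative value would persist towards minus infinity, where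
    [Phi] vanishes and the other term is positive. *)
Lemma mills_upper x : x < 0 -> mills x <= / (- x).
Proof.
  intros Hx.
  set (D := fun y => gauss y / (- y) - Phi y).
  assert (Hmono : forall y, y <= x -> D y <= D x).
  { intros y Hy. apply (nondecreasing_of_derive D (fun z => gauss z / z ^ 2)); [exact Hy| |].
    - intros z Hz. pose proof (cdf_derive z) as H1. pose proof (gauss_derive z) as H2.
      unfold D. auto_derive.
      + repeat split; try lra; eexists; [exact H2|exact H1].
      + replace (Derive (fun w => Phi w) z) with (gauss z)
          by (symmetry; now apply is_derive_unique).
        replace (Derive (fun w => gauss w) z) with (- z * gauss z)
          by (symmetry; now apply is_derive_unique).
        field. lra.
    - intros z Hz. apply Rlt_le, Rdiv_lt_0_compat; [apply gauss_pos|nra]. }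
  assert (HD : 0 <= D x).
  { apply Rnot_lt_le. intros Hn.
    destruct (proj2 HPhi (- D x)) as [A HA]; [lra|].
    pose proof (HA (Rmin A x) (Rmin_l _ _)) as H1. apply Rabs_def2 in H1.
    pose proof (Hmono (Rmin A x) (Rmin_r _ _)) as H2.
    pose proof (Rmin_r A x).
    assert (0 < gauss (Rmin A x) / (- Rmin A x))
      by (apply Rdiv_lt_0_compat; [apply gauss_pos|lra]).
    unfold D in H2 at 1. lra. }
  unfold mills. pose proof (gauss_pos x) as Hg.
  apply (Rmult_le_reg_r (gauss x)); [exact Hg|].
  unfold D in HD. unfold Rdiv. rewrite Rmult_assoc, Rinv_l by lra. lra.
Qed.

(** As in [mills_upper], but the negative part of [D] is now at most [1 / - y], which vanishes at
    minus infinity; the chosen [y] makes it at most half of [- D x]. *)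
Lemma mills_lower x : x < 0 -> - x / (1 + x ^ 2) <= mills x.
Proof.
  intros Hx.
  set (D := fun y => Phi y - gauss y * (- y) / (1 + y ^ 2)).
  assert (Hmono : forall y, y <= x -> D y <= D x).
  { intros y Hy.
    apply (nondecreasing_of_derive D (fun z => 2 * gauss z / (1 + z ^ 2) ^ 2)); [exact Hy| |].
    - intros z Hz. pose proof (cdf_derive z) as H1. pose proof (gauss_derive z) as H2.
      pose proof (pow2_ge_0 z).
      unfold D. auto_derive.
      + repeat split; try nra; eexists; [exact H1|exact H2].
      + replace (Derive (fun w => Phi w) z) with (gauss z)
          by (symmetry; now apply is_derive_unique).
        replace (Derive (fun w => gauss w) z) with (- z * gauss z)
          by (symmetry; now apply is_derive_unique).
        field. nra.
    - intros z Hz. pose proof (pow2_ge_0 z). pose proof (gauss_pos z).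
      apply Rlt_le, Rdiv_lt_0_compat; [lra|apply pow_lt; lra]. }
  assert (HD : 0 <= D x).
  { apply Rnot_lt_le. intros Hn.
    set (y := Rmin x (2 / D x)).
    pose proof (Hmono y (Rmin_l _ _)) as H2.
    assert (Hy : y < 0) by (pose proof (Rmin_l x (2 / D x)); unfold y; lra).
    assert (Hy2 : 1 / (- y) <= - D x / 2).
    { apply (Rmult_le_reg_r (- y)); [lra|].
      replace (1 / - y * - y) with 1 by (field; lra).
      assert (y <= 2 / D x) by apply Rmin_r.
      assert (E : - D x / 2 * - (2 / D x) = 1) by (field; lra).
      nra. }
    assert (Hg : gauss y * - y / (1 + y ^ 2) <= 1 / - y).
    { apply (Rmult_le_reg_r ((1 + y ^ 2) * - y)); [nra|].
      replace (gauss y * - y / (1 + y ^ 2) * ((1 + y ^ 2) * - y))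
        with (gauss y * y ^ 2) by (field; nra).
      replace (1 / - y * ((1 + y ^ 2) * - y)) with (1 + y ^ 2) by (field; lra).
      pose proof (gauss_le_1 y). pose proof (pow2_ge_0 y). nra. }
    pose proof (cdf_ge0 y). unfold D in H2 at 1. lra. }
  unfold mills. pose proof (gauss_pos x) as Hg. pose proof (pow2_ge_0 x).
  apply (Rmult_le_reg_r (gauss x)); [exact Hg|].
  unfold D in HD. unfold Rdiv at 2. rewrite Rmult_assoc, Rinv_l by lra.
  unfold Rdiv in *. lra.
Qed.

(** Up to a factor in [[0, 1]], and after adding one to the second, these are the Stein solution,
    its derivative, and the derivative of [x] times the solution in the left tail. *)
Lemma mills_bounds x :
  x <= -1 ->
  0 <= mills x <= 1 /\ -1 <= x * mills x <= 0 /\ 0 <= (1 + x ^ 2) * mills x + x <= 1.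
Proof.
  intros Hx. pose proof (mills_upper x ltac:(lra)) as Hu.
  pose proof (mills_lower x ltac:(lra)) as Hl.
  assert (H0 : 0 <= mills x).
  { apply Rmult_le_pos; [apply cdf_ge0|]. apply Rlt_le, Rinv_0_lt_compat, gauss_pos. }
  assert (Hi : 0 < / - x <= 1).
  { split; [apply Rinv_0_lt_compat; lra|].
    rewrite <- Rinv_1. apply Rinv_le_contravar; lra. }
  assert (Hxi : x * / - x = -1) by (field; lra).
  assert (Hl' : - x <= (1 + x ^ 2) * mills x).
  { apply (Rmult_le_compat_l (1 + x ^ 2)) in Hl; [|nra].
    replace ((1 + x ^ 2) * (- x / (1 + x ^ 2))) with (- x) in Hl by (field; nra). exact Hl. }
  assert (Hu' : (1 + x ^ 2) * mills x <= (1 + x ^ 2) * / - x)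
    by (apply Rmult_le_compat_l; [nra|exact Hu]).
  replace ((1 + x ^ 2) * / - x) with (/ - x - x) in Hu' by (field; lra).
  repeat split; nra.
Qed.

End NormalCdf.

(** * Stein's equation *)

Lemma lipschitz_of_derive (f df : R -> R) K :
  (forall x, is_derive f x (df x)) -> (forall x, Rabs (df x) <= K) ->
  forall x y, Rabs (f x - f y) <= K * Rabs (x - y).
Proof.
  intros Hd HK x y.
  destruct (MVT_gen f y x df) as [z [_ Hz]].
  - intros; apply Hd.
  - intros w _. apply derivable_continuous_pt. exists (df w). apply is_derive_Reals, Hd.
  - rewrite Hz, Rabs_mult. apply Rmult_le_compat_r; [apply Rabs_pos|apply HK].
Qed.

Lemma constant_of_derive (f : R -> R) a b :
  (forall x, Rmin a b <= x <= Rmax a b -> is_derive f x 0) -> f a = f b.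
Proof.
  intros Hd. destruct (MVT_gen f a b (fun _ => 0)) as [z [_ Hz]].
  - intros x Hx. apply Hd. lra.
  - intros w Hw. apply derivable_continuous_pt. exists 0. now apply is_derive_Reals, Hd.
  - lra.
Qed.

Lemma continuous_bounded (f : R -> R) a b :
  a <= b -> (forall x, a <= x <= b -> continuous f x) ->
  exists K, 0 <= K /\ forall x, a <= x <= b -> Rabs (f x) <= K.
Proof.
  intros Hab Hc.
  destruct (continuity_ab_maj (fun x => Rabs (f x)) a b Hab) as [m [Hm _]].
  - intros x Hx. apply (continuity_pt_comp f Rabs).
    + apply continuity_pt_filterlim, Hc, Hx.
    + apply Rcontinuity_abs.
  - exists (Rabs (f m)). split; [apply Rabs_pos|exact Hm].
Qed.

(** A continuous substitute for the indicator of the half-line up to [c]. Being Lipschitz, it yields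
    a Stein solution with Lipschitz derivative. *)
Definition ramp (c d x : R) : R := Rmax 0 (Rmin 1 ((c + d - x) / d)).

Lemma ramp_bounds c d x : 0 <= ramp c d x <= 1.
Proof.
  unfold ramp. split; [apply Rmax_l|]. apply Rmax_lub; [lra|apply Rmin_l].
Qed.

Lemma ramp_left c d x : 0 < d -> x <= c -> ramp c d x = 1.
Proof.
  intros Hd Hx. unfold ramp.
  assert (1 <= (c + d - x) / d).
  { apply (Rmult_le_reg_r d); [exact Hd|]. unfold Rdiv.
    rewrite Rmult_assoc, Rinv_l by lra. lra. }
  rewrite Rmin_left, Rmax_right; lra.
Qed.

Lemma ramp_right c d x : 0 < d -> c + d <= x -> ramp c d x = 0.
Proof.
  intros Hd Hx. unfold ramp.
  assert ((c + d - x) / d <= 0).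
  { apply (Rmult_le_reg_r d); [exact Hd|]. unfold Rdiv.
    rewrite Rmult_assoc, Rinv_l by lra. lra. }
  rewrite Rmin_right, Rmax_left; lra.
Qed.

Lemma ramp_lipschitz c d x y :
  0 < d -> Rabs (ramp c d x - ramp c d y) <= / d * Rabs (x - y).
Proof.
  intros Hd.
  assert (E : / d * Rabs (x - y) = Rabs ((c + d - x) / d - (c + d - y) / d)).
  { replace ((c + d - x) / d - (c + d - y) / d) with (- (/ d * (x - y))) by (field; lra).
    rewrite Rabs_Ropp, Rabs_mult, (Rabs_pos_eq (/ d)); [reflexivity|].
    now apply Rlt_le, Rinv_0_lt_compat. }
  rewrite E. unfold ramp.
  generalize ((c + d - x) / d) as u. generalize ((c + d - y) / d) as v. intros v u.
  unfold Rmax, Rmin.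
  repeat destruct Rle_dec; unfold Rabs; repeat destruct Rcase_abs; lra.
Qed.

Lemma ramp_continuous c d x : 0 < d -> continuous (ramp c d) x.
Proof.
  intros Hd. apply continuity_pt_filterlim. intros eps Heps.
  exists (eps * d). split; [now apply Rmult_lt_0_compat|].
  intros y [_ Hy]. simpl in *. unfold R_dist in *.
  eapply Rle_lt_trans; [now apply ramp_lipschitz|].
  apply (Rmult_lt_reg_l d); [exact Hd|].
  rewrite <- Rmult_assoc, Rinv_r by lra. lra.
Qed.

Section SteinEquation.
Variable Phi : R -> R.
Hypothesis HPhi : is_std_normal_cdf Phi.
Variables c d : R.
Hypothesis Hd : 0 < d.

Let cd := cdf_derive Phi HPhi.

(** The integral of [ramp * gauss] from minus infinity, split at [c], left of which the ramp is one;
    this avoids improper integrals. As the ramp vanishes beyond [c + d], [ramp_mean] is its full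
    Gaussian mean. *)
Definition ramp_primitive (x : R) : R :=
  Phi c + RInt (fun t => ramp c d t * gauss t) c x.
Definition ramp_mean : R := ramp_primitive (c + d).
(** The bounded solution of Stein's equation [f' - x f = ramp - ramp_mean]; [stein_sol'] is read off
    from the equation. *)
Definition stein_sol (x : R) : R :=
  (ramp_primitive x - ramp_mean * Phi x) / gauss x.
Definition stein_sol' (x : R) : R := x * stein_sol x + ramp c d x - ramp_mean.

Lemma ramp_primitive_derive x :
  is_derive ramp_primitive x (ramp c d x * gauss x).
Proof.
  unfold ramp_primitive.
  replace (ramp c d x * gauss x) with (0 + ramp c d x * gauss x) by ring.
  apply (@is_derive_plus R_AbsRing R_NormedModule); [apply @is_derive_const|].
  assert (Hc : forall t, continuous (fun t => ramp c d t * gauss t) t).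
  { intros t. apply (@continuous_mult R_UniformSpace R_AbsRing).
    - now apply ramp_continuous.
    - apply gauss_continuous. }
  apply (is_derive_RInt (fun t => ramp c d t * gauss t) _ c).
  - apply filter_forall. intros y. apply (@RInt_correct R_CompleteNormedModule).
    apply (@ex_RInt_continuous R_CompleteNormedModule). intros t _. apply Hc.
  - apply Hc.
Qed.

Lemma ramp_primitive_c : ramp_primitive c = Phi c.
Proof.
  unfold ramp_primitive. rewrite RInt_point. change zero with 0. apply Rplus_0_r.
Qed.

Lemma ramp_primitive_left x : x <= c -> ramp_primitive x = Phi x.
Proof.
  intros Hx.
  assert (E : ramp_primitive x - Phi x = ramp_primitive c - Phi c).
  { apply (constant_of_derive (fun y => ramp_primitive y - Phi y)).
    intros y Hy. rewrite Rmin_left, Rmax_right in Hy by lra.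
    replace 0 with (ramp c d y * gauss y - gauss y) by (rewrite ramp_left by lra; ring).
    apply (@is_derive_minus R_AbsRing R_NormedModule);
      [apply ramp_primitive_derive|apply cd]. }
  rewrite ramp_primitive_c in E. lra.
Qed.

Lemma ramp_primitive_right x : c + d <= x -> ramp_primitive x = ramp_mean.
Proof.
  intros Hx. unfold ramp_mean. symmetry. apply constant_of_derive.
  intros y Hy. rewrite Rmin_left, Rmax_right in Hy by lra.
  replace 0 with (ramp c d y * gauss y) by (rewrite ramp_right by lra; ring).
  apply ramp_primitive_derive.
Qed.

Lemma ramp_mean_bounds : Phi c <= ramp_mean <= Phi (c + d).
Proof.
  unfold ramp_mean. split.
  - rewrite <- ramp_primitive_c.
    apply (nondecreasing_of_derive _ (fun x => ramp c d x * gauss x)); [lra| |].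
    + intros; apply ramp_primitive_derive.
    + intros x _. apply Rmult_le_pos; [apply ramp_bounds|apply Rlt_le, gauss_pos].
  - assert (H : Phi c - ramp_primitive c <= Phi (c + d) - ramp_primitive (c + d)).
    { apply (nondecreasing_of_derive (fun x => Phi x - ramp_primitive x)
              (fun x => gauss x - ramp c d x * gauss x)); [lra| |].
      + intros x _. apply (@is_derive_minus R_AbsRing R_NormedModule);
          [apply cd|apply ramp_primitive_derive].
      + intros x _. pose proof (ramp_bounds c d x). pose proof (gauss_pos x). nra. }
    rewrite ramp_primitive_c in H. lra.
Qed.

Lemma stein_sol_derive x : is_derive stein_sol x (stein_sol' x).
Proof.
  unfold stein_sol', stein_sol.
  pose proof (gauss_pos x) as Hg. pose proof (cd x) as H1.
  pose proof (ramp_primitive_derive x) as H2. pose proof (gauss_derive x) as H3.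
  auto_derive.
  - repeat split; try lra; eexists; [exact H2|exact H1|exact H3].
  - replace (Derive (fun w => Phi w) x) with (gauss x)
      by (symmetry; now apply is_derive_unique).
    replace (Derive (fun w => ramp_primitive w) x) with (ramp c d x * gauss x)
      by (symmetry; now apply is_derive_unique).
    replace (Derive (fun w => gauss w) x) with (- x * gauss x)
      by (symmetry; now apply is_derive_unique).
    field. lra.
Qed.

Lemma stein_sol_left x : x <= c -> stein_sol x = (1 - ramp_mean) * mills Phi x.
Proof.
  intros Hx. unfold stein_sol, mills. rewrite ramp_primitive_left by exact Hx.
  unfold Rdiv. ring.
Qed.

Lemma stein_sol_right x : c + d <= x -> stein_sol x = ramp_mean * mills Phi (- x).
Proof.
  intros Hx. unfold stein_sol, mills. rewrite ramp_primitive_right by exact Hx.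
  rewrite gauss_opp. pose proof (cdf_sym Phi HPhi x).
  replace (Phi (- x)) with (1 - Phi x) by lra. unfold Rdiv. ring.
Qed.

(** The threshold lies beyond the ramp, where the test function is constant, and beyond one, where
    [mills_bounds] applies to [x] or [- x]. *)
Lemma stein_sol_tail x :
  x <= - (1 + Rabs c + d) \/ 1 + Rabs c + d <= x ->
  Rabs (stein_sol x) <= 1 /\ Rabs (stein_sol' x) <= 2 /\
  Rabs (stein_sol x + x * stein_sol' x) <= 1.
Proof.
  intros Hx. unfold stein_sol'.
  pose proof (Rle_abs c) as Hc1. pose proof (Rle_abs (- c)) as Hc2. rewrite Rabs_Ropp in Hc2.
  pose proof ramp_mean_bounds as HN.
  pose proof (cdf_ge0 Phi HPhi c). pose proof (cdf_le1 Phi HPhi (c + d)).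
  pose proof (Rabs_pos c).
  destruct Hx as [Hx|Hx].
  - rewrite stein_sol_left, ramp_left by lra.
    destruct (mills_bounds Phi HPhi x ltac:(lra)) as [Hm1 [Hm2 Hm3]].
    set (m := mills Phi x) in *. set (N := ramp_mean) in *.
    repeat split; apply Rabs_le.
    + nra.
    + nra.
    + replace ((1 - N) * m + x * (x * ((1 - N) * m) + 1 - N))
        with ((1 - N) * ((1 + x ^ 2) * m + x)) by ring. nra.
  - rewrite stein_sol_right, ramp_right by lra.
    destruct (mills_bounds Phi HPhi (- x) ltac:(lra)) as [Hm1 [Hm2 Hm3]].
    set (m := mills Phi (- x)) in *. set (N := ramp_mean) in *.
    repeat split; apply Rabs_le.
    + nra.
    + nra.
    + replace (N * m + x * (x * (N * m) + 0 - N))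
        with (N * ((1 + (- x) ^ 2) * m + - x)) by ring. nra.
Qed.

(** Compactness on [[-A, A]], Mills bounds outside. The constants need not be explicit: they depend
    on [Phi], [c] and [d], which stay fixed as [T] grows. *)
Lemma stein_sol_bounds : exists K0 K1 L,
  0 <= K0 /\ 0 <= K1 /\ 0 <= L /\
  (forall x, Rabs (stein_sol x) <= K0) /\ (forall x, Rabs (stein_sol' x) <= K1) /\
  (forall x y, Rabs (stein_sol' x - stein_sol' y) <= L * Rabs (x - y)).
Proof.
  set (A := 1 + Rabs c + d). pose proof (Rabs_pos c).
  assert (Hsc : forall x, continuous stein_sol x).
  { intros x. apply ex_derive_R_continuous. eexists. apply stein_sol_derive. }
  assert (Hsc' : forall x, continuous stein_sol' x).
  { intros x. unfold stein_sol'.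
    apply (@continuous_minus R_UniformSpace R_AbsRing R_NormedModule);
      [|apply continuous_const].
    apply (@continuous_plus R_UniformSpace R_AbsRing R_NormedModule);
      [|now apply ramp_continuous].
    apply (@continuous_mult R_UniformSpace R_AbsRing); [apply continuous_id|apply Hsc]. }
  assert (Hcase : forall x, - A <= x <= A \/ (x <= - A \/ A <= x)) by (intros; lra).
  destruct (continuous_bounded stein_sol (- A) A) as [B0 [HB0 HB0']];
    [unfold A; lra|intros; apply Hsc|].
  destruct (continuous_bounded stein_sol' (- A) A) as [B1 [HB1 HB1']];
    [unfold A; lra|intros; apply Hsc'|].
  assert (HAB : 0 <= A * B1) by (apply Rmult_le_pos; unfold A; lra).
  pose proof (Rinv_0_lt_compat d Hd) as Hid.
  exists (B0 + 1), (B1 + 2), (B0 + A * B1 + 1 + / d).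
  repeat split; try lra.
  - intros x. destruct (Hcase x) as [Hx|Hx].
    + pose proof (HB0' x Hx). lra.
    + destruct (stein_sol_tail x Hx) as [H0 _]. lra.
  - intros x. destruct (Hcase x) as [Hx|Hx].
    + pose proof (HB1' x Hx). lra.
    + destruct (stein_sol_tail x Hx) as [_ [H0 _]]. lra.
  - intros x y.
    assert (HL : Rabs (x * stein_sol x - y * stein_sol y)
                 <= (B0 + A * B1 + 1) * Rabs (x - y)).
    { apply (lipschitz_of_derive (fun z => z * stein_sol z)
              (fun z => stein_sol z + z * stein_sol' z)).
      - intros z. pose proof (stein_sol_derive z) as Hz.
        auto_derive; [eexists; exact Hz|].
        replace (Derive (fun w => stein_sol w) z) with (stein_sol' z)
          by (symmetry; now apply is_derive_unique). ring.
      - intros z. destruct (Hcase z) as [Hz|Hz].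
        + eapply Rle_trans; [apply Rabs_triang|]. rewrite Rabs_mult.
          pose proof (HB0' z Hz).
          assert (Rabs z * Rabs (stein_sol' z) <= A * B1).
          { apply Rmult_le_compat; try apply Rabs_pos; [now apply Rabs_le|now apply HB1']. }
          lra.
        + destruct (stein_sol_tail z Hz) as [_ [_ H0]]. lra. }
    unfold stein_sol'.
    replace (x * stein_sol x + ramp c d x - ramp_mean
             - (y * stein_sol y + ramp c d y - ramp_mean))
      with ((x * stein_sol x - y * stein_sol y) + (ramp c d x - ramp c d y)) by ring.
    eapply Rle_trans; [apply Rabs_triang|].
    pose proof (ramp_lipschitz c d x y Hd). lra.
Qed.

End SteinEquation.

(** * Stein's method along a path *)

Section Walk.
Variables (w Y : Z -> R) (M : nat).

(** The expectation of [phi] after [n] independent steps [Y] with weights [w]. The weights may have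
    mass below one, because truncation loses mass. *)
Fixpoint walk (n : nat) (phi : R -> R) (s : R) : R :=
  match n with
  | O => phi s
  | S n' => zsum M (fun k => w k * walk n' phi (s + Y k))
  end.

Hypothesis w_ge0 : forall k, 0 <= w k.
Hypothesis w_mass : zsum M w <= 1.

Lemma walk_le n phi psi s :
  (forall x, phi x <= psi x) -> walk n phi s <= walk n psi s.
Proof.
  intros H. revert s. induction n as [|n IH]; intros s; cbn [walk]; [apply H|].
  apply zsum_le. intros k _. apply Rmult_le_compat_l; [apply w_ge0|apply IH].
Qed.

Lemma walk_ext n phi psi s :
  (forall x, phi x = psi x) -> walk n phi s = walk n psi s.
Proof. intros H. apply Rle_antisym; apply walk_le; intros x; rewrite H; lra. Qed.

Lemma walk_lin n a b phi psi s :
  walk n (fun x => a * phi x + b * psi x) s = a * walk n phi s + b * walk n psi s.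
Proof.
  revert s. induction n as [|n IH]; intros s; cbn [walk]; [reflexivity|].
  rewrite <- !zsum_scal, <- zsum_plus. apply zsum_ext. intros k _. rewrite IH. ring.
Qed.

Lemma walk_shift n phi s y : walk n phi (s + y) = walk n (fun x => phi (x + y)) s.
Proof.
  revert s. induction n as [|n IH]; intros s; cbn [walk]; [reflexivity|].
  apply zsum_ext. intros k _. rewrite <- IH. do 2 f_equal. ring.
Qed.

Lemma walk_const n a s : walk n (fun _ => a) s = a * zsum M w ^ n.
Proof.
  revert s. induction n as [|n IH]; intros s; cbn [walk pow]; [ring|].
  rewrite (zsum_ext M _ (fun k => (a * zsum M w ^ n) * w k))
    by (intros; rewrite IH; ring).
  rewrite zsum_scal. ring.
Qed.

Lemma walk_mass_pow n : 0 <= zsum M w ^ n <= 1.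
Proof.
  pose proof (zsum_ge0 M w w_ge0). split; [now apply pow_le|].
  rewrite <- (pow1 n). now apply pow_incr.
Qed.

Lemma walk_bound n phi s K :
  (forall x, Rabs (phi x) <= K) -> Rabs (walk n phi s) <= K.
Proof.
  intros H. pose proof (walk_mass_pow n) as Hm.
  assert (HK : 0 <= K) by (eapply Rle_trans; [apply (Rabs_pos (phi 0))|apply H]).
  assert (H1 : walk n phi s <= walk n (fun _ => K) s).
  { apply walk_le. intros x. specialize (H x). apply Rabs_le_between in H. lra. }
  assert (H2 : walk n (fun _ => - K) s <= walk n phi s).
  { apply walk_le. intros x. specialize (H x). apply Rabs_le_between in H. lra. }
  rewrite walk_const in H1, H2. apply Rabs_le. nra.
Qed.

Lemma walk_mean n beta s :
  0 <= s -> 0 <= beta -> (forall k, 0 <= Y k) -> zsum M (fun k => w k * Y k) <= beta ->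
  walk n (fun x => x) s <= s + INR n * beta.
Proof.
  intros Hs Hb HY Hbeta. revert s Hs. induction n as [|n IH]; intros s Hs; cbn [walk].
  - simpl. lra.
  - pose proof (pos_INR n) as Hn.
    apply Rle_trans with (zsum M (fun k => (s + INR n * beta) * w k + w k * Y k)).
    + apply zsum_le. intros k _. pose proof (w_ge0 k). pose proof (HY k).
      pose proof (IH (s + Y k) ltac:(lra)). nra.
    + rewrite zsum_plus, zsum_scal, S_INR.
      assert (0 <= INR n * beta) by now apply Rmult_le_pos. nra.
Qed.

(** Truncation leaves a mean [mu] of size [delta] instead of zero. Its cross term obeys
    [2 s mu <= delta (1 + s^2)], which costs a factor [1 + delta] per step. *)
Lemma walk_second_moment n delta V s :
  0 <= delta -> 0 <= V ->
  Rabs (zsum M (fun k => w k * Y k)) <= delta ->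
  zsum M (fun k => w k * Y k ^ 2) <= V ->
  walk n (fun x => x ^ 2) s <= (1 + delta) ^ n * (s ^ 2 + INR n * (delta + V)).
Proof.
  intros Hd HV Hm H2. revert s. induction n as [|n IH]; intros s; cbn [walk].
  - simpl. lra.
  - pose proof (pos_INR n) as Hn. set (C := delta + V) in *.
    assert (HC : 0 <= INR n * C) by (apply Rmult_le_pos; unfold C; lra).
    assert (Hp : 0 < (1 + delta) ^ n) by (apply pow_lt; lra).
    apply Rle_trans with (zsum M (fun k =>
      (1 + delta) ^ n * ((s ^ 2 + INR n * C) * w k + 2 * s * (w k * Y k) + w k * Y k ^ 2))).
    + apply zsum_le. intros k _. pose proof (w_ge0 k). pose proof (IH (s + Y k)) as HI.
      apply (Rmult_le_compat_l (w k)) in HI; [|lra].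
      eapply Rle_trans; [exact HI|]. right. ring.
    + rewrite zsum_scal, !zsum_plus, !zsum_scal, S_INR.
      change ((1 + delta) ^ S n) with ((1 + delta) * (1 + delta) ^ n).
      rewrite (Rmult_comm (1 + delta)), (Rmult_assoc ((1 + delta) ^ n) (1 + delta)).
      apply Rmult_le_compat_l; [lra|].
      set (mu := zsum M (fun k => w k * Y k)) in *.
      assert (Hs : 2 * s * mu <= delta * (1 + s ^ 2)).
      { apply Rabs_le_between in Hm. pose proof (pow2_ge_0 (s - 1)).
        pose proof (pow2_ge_0 (s + 1)).
        destruct (Rle_lt_dec 0 s); nra. }
      assert ((s ^ 2 + INR n * C) * zsum M w <= (s ^ 2 + INR n * C) * 1).
      { apply Rmult_le_compat_l; [pose proof (pow2_ge_0 s); lra|exact w_mass]. }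
      assert (0 <= delta * (INR n * C)) by now apply Rmult_le_pos.
      assert (0 <= delta * C) by (apply Rmult_le_pos; unfold C; lra).
      unfold C in *. nra.
Qed.

(** * Stein's bound for a sum of independent steps *)

Section SteinBound.
Variables (F F1 : R -> R) (K0 K1 L sig2 delta C1 C3 : R).
Hypothesis HF : forall x, Rabs (F x) <= K0.
Hypothesis HF1 : forall x, Rabs (F1 x) <= K1.
Hypothesis HL : 0 <= L.
Hypothesis Hsig : 0 <= sig2.
Hypothesis Htaylor : forall x y, Rabs (F (x + y) - F x - y * F1 x) <= L * y ^ 2.
Hypothesis Hlip : forall x y, Rabs (F1 (x + y) - F1 x) <= L * Rabs y.
Hypothesis Hmean : Rabs (zsum M (fun k => w k * Y k)) <= delta.
Hypothesis Hvar : Rabs (zsum M (fun k => w k * Y k ^ 2) - sig2 * zsum M w) <= delta.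
Hypothesis Habs1 : zsum M (fun k => w k * Rabs (Y k)) <= C1.
Hypothesis Habs3 : zsum M (fun k => w k * Rabs (Y k) ^ 3) <= C3.

(** [walk n F] inherits the Taylor and Lipschitz bounds of [F] and [F1], since [walk] is linear and
    does not increase uniform bounds. Expanding in [Y k] leaves the defects [Hmean] and [Hvar] and a
    rest controlled by [Habs1] and [Habs3]. *)
Lemma stein_step n s :
  Rabs (zsum M (fun k => w k * (Y k * walk n F (s + Y k) - sig2 * walk n F1 (s + Y k))))
  <= delta * K0 + delta * K1 + L * (C3 + sig2 * C1).
Proof.
  set (P := walk n F) in *. set (P1 := walk n F1) in *.
  set (rho := fun k => P (s + Y k) - P s - Y k * P1 s).
  set (rho1 := fun k => P1 (s + Y k) - P1 s).
  assert (Hr : forall k, Rabs (rho k) <= L * Y k ^ 2).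
  { intros k. unfold rho, P, P1. rewrite walk_shift.
    replace (walk n (fun x => F (x + Y k)) s - walk n F s - Y k * walk n F1 s)
      with (walk n (fun x => 1 * (1 * F (x + Y k) + (-1) * F x) + (- Y k) * F1 x) s)
      by (rewrite (walk_lin n 1 (- Y k) (fun x => 1 * F (x + Y k) + (-1) * F x) F1),
            (walk_lin n 1 (-1) (fun x => F (x + Y k)) F); ring).
    apply walk_bound. intros x. eapply Rle_trans; [|apply (Htaylor x (Y k))].
    right. apply f_equal. ring. }
  assert (Hr1 : forall k, Rabs (rho1 k) <= L * Rabs (Y k)).
  { intros k. unfold rho1, P1. rewrite walk_shift.
    replace (walk n (fun x => F1 (x + Y k)) s - walk n F1 s)
      with (walk n (fun x => 1 * F1 (x + Y k) + (-1) * F1 x) s)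
      by (rewrite (walk_lin n 1 (-1) (fun x => F1 (x + Y k)) F1); ring).
    apply walk_bound. intros x. eapply Rle_trans; [|apply (Hlip x (Y k))].
    right. apply f_equal. ring. }
  rewrite (zsum_ext M _ (fun k => P s * (w k * Y k)
     + (P1 s * (w k * Y k ^ 2) - (P1 s * sig2) * w k)
     + w k * (Y k * rho k - sig2 * rho1 k)))
    by (intros k _; unfold rho, rho1; ring).
  rewrite !zsum_plus, zsum_minus, !zsum_scal.
  assert (H1 : Rabs (P s * zsum M (fun k => w k * Y k)) <= delta * K0).
  { rewrite Rabs_mult, Rmult_comm. apply Rmult_le_compat; try apply Rabs_pos;
      [exact Hmean|now apply walk_bound]. }
  assert (H2 : Rabs (P1 s * zsum M (fun k => w k * Y k ^ 2) - P1 s * sig2 * zsum M w)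
               <= delta * K1).
  { replace (P1 s * zsum M (fun k => w k * Y k ^ 2) - P1 s * sig2 * zsum M w)
      with (P1 s * (zsum M (fun k => w k * Y k ^ 2) - sig2 * zsum M w)) by ring.
    rewrite Rabs_mult, Rmult_comm. apply Rmult_le_compat; try apply Rabs_pos;
      [exact Hvar|now apply walk_bound]. }
  assert (H3 : Rabs (zsum M (fun k => w k * (Y k * rho k - sig2 * rho1 k)))
               <= L * (C3 + sig2 * C1)).
  { eapply Rle_trans; [apply zsum_abs|].
    apply Rle_trans with (zsum M (fun k =>
      L * (w k * Rabs (Y k) ^ 3) + L * sig2 * (w k * Rabs (Y k)))).
    - apply zsum_le. intros k _. pose proof (w_ge0 k) as Hw.
      rewrite Rabs_mult, (Rabs_pos_eq (w k)) by exact Hw.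
      assert (Hb : Rabs (Y k * rho k - sig2 * rho1 k)
                   <= L * Rabs (Y k) ^ 3 + L * sig2 * Rabs (Y k)).
      { eapply Rle_trans; [apply Rabs_triang|].
        rewrite Rabs_Ropp, !Rabs_mult, (Rabs_pos_eq sig2) by exact Hsig.
        pose proof (Hr k) as Hrk. pose proof (Hr1 k) as Hr1k.
        rewrite <- (pow2_abs (Y k)) in Hrk. pose proof (Rabs_pos (Y k)).
        apply (Rmult_le_compat_l (Rabs (Y k))) in Hrk; [|lra].
        apply (Rmult_le_compat_l sig2) in Hr1k; [|lra]. lra. }
      apply (Rmult_le_compat_l (w k)) in Hb; [|exact Hw].
      eapply Rle_trans; [exact Hb|]. right. ring.
    - rewrite zsum_plus, !zsum_scal.
      apply (Rmult_le_compat_l L) in Habs3; [|exact HL].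
      apply (Rmult_le_compat_l (L * sig2)) in Habs1; [|now apply Rmult_le_pos].
      lra. }
  eapply Rle_trans; [apply Rabs_triang|].
  pose proof (Rabs_triang (P s * zsum M (fun k => w k * Y k))
    (P1 s * zsum M (fun k => w k * Y k ^ 2) - P1 s * sig2 * zsum M w)). lra.
Qed.

(* Conditioning on the first increment only keeps the bound uniform in the
   starting point, so no exchange of summations is needed. *)
Lemma stein_walk n s :
  Rabs (walk n (fun x => (x - s) * F x - INR n * sig2 * F1 x) s)
  <= INR n * (delta * K0 + delta * K1 + L * (C3 + sig2 * C1)).
Proof.
  set (kap := delta * K0 + delta * K1 + L * (C3 + sig2 * C1)).
  revert s. induction n as [|n IH]; intros s.
  - cbn [walk]. simpl INR.
    replace ((s - s) * F s - 0 * sig2 * F1 s) with 0 by ring. rewrite Rabs_R0. lra.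
  - cbn [walk].
    (* [x - s] splits into [x - (s + Y k)], which feeds the induction hypothesis started at
       [s + Y k], and [Y k], which [stein_step] handles. *)
    rewrite (zsum_ext M _ (fun k =>
      w k * walk n (fun x => (x - (s + Y k)) * F x - INR n * sig2 * F1 x) (s + Y k)
      + w k * (Y k * walk n F (s + Y k) - sig2 * walk n F1 (s + Y k)))).
    + rewrite zsum_plus. eapply Rle_trans; [apply Rabs_triang|].
      rewrite S_INR, Rmult_plus_distr_r, Rmult_1_l.
      apply Rplus_le_compat; [|apply stein_step].
      eapply Rle_trans; [apply zsum_abs|].
      apply Rle_trans with (zsum M (fun k => (INR n * kap) * w k)).
      * apply zsum_le. intros k _. pose proof (w_ge0 k) as Hw.
        rewrite Rabs_mult, (Rabs_pos_eq (w k)) by exact Hw.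
        rewrite Rmult_comm. apply Rmult_le_compat_r; [exact Hw|apply IH].
      * rewrite zsum_scal. rewrite <- (Rmult_1_r (INR n * kap)) at 2.
        apply Rmult_le_compat_l; [|exact w_mass].
        eapply Rle_trans; [apply Rabs_pos|apply (IH s)].
    + intros k _. rewrite <- Rmult_plus_distr_l. f_equal.
      rewrite (walk_ext n _ (fun x =>
        1 * ((x - (s + Y k)) * F x - INR n * sig2 * F1 x)
        + 1 * (Y k * F x + (- sig2) * F1 x))) by (intros x; rewrite S_INR; ring).
      rewrite walk_lin, (walk_lin n (Y k) (- sig2)). ring.
Qed.
End SteinBound.
End Walk.

Fixpoint path_sum (b : Z -> R) (prev : Z) (l : list Z) : R :=
  match l with
  | nil => 0
  | y :: l' => b (y - prev)%Z + path_sum b y l'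
  end.

Lemma incr_expect_walk lam b M n phi z s :
  incr_expect lam n M z (fun l => phi (s + path_sum b z l))
  = walk (incr_pmf lam) b M n phi s.
Proof.
  assert (Hext : forall m y f g, (forall l, f l = g l) ->
      incr_expect lam m M y f = incr_expect lam m M y g).
  { induction m as [|m IH]; intros y f g H; cbn [incr_expect]; [apply H|].
    apply zsum_ext. intros k _. f_equal. apply IH. intros l. apply H. }
  revert z s. induction n as [|n IH]; intros z s; cbn [incr_expect walk path_sum].
  - now rewrite Rplus_0_r.
  - apply zsum_ext. intros k _. f_equal. rewrite <- (IH (z + k)%Z).
    apply Hext. intros l. replace (z + k - z)%Z with k by lia. f_equal. ring.
Qed.

Lemma incr_expect_lin lam n M z a b g1 g2 :
  incr_expect lam n M z (fun l => a * g1 l + b * g2 l)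
  = a * incr_expect lam n M z g1 + b * incr_expect lam n M z g2.
Proof.
  revert z g1 g2. induction n as [|n IH]; intros z g1 g2; cbn [incr_expect]; [reflexivity|].
  rewrite <- !zsum_scal, <- zsum_plus. apply zsum_ext. intros k _.
  rewrite (IH (z + k)%Z (fun l => g1 ((z + k)%Z :: l)) (fun l => g2 ((z + k)%Z :: l))). ring.
Qed.

(** * Moments of the standardised squared increment *)

(** The Gaussian score in the variance, multiplied by [2 * x]. *)
Definition chi (x : R) (k : Z) : R := IZR k ^ 2 / x - 1.

Lemma Un_cv_lin3 (u v w : nat -> R) a b c lu lv lw :
  Un_cv u lu -> Un_cv v lv -> Un_cv w lw ->
  Un_cv (fun n => a * u n + b * v n + c * w n) (a * lu + b * lv + c * lw).
Proof.
  intros Hu Hv Hw.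
  assert (Hs : forall e z l, Un_cv z l -> Un_cv (fun n => e * z n) (e * l)).
  { intros e z l Hz. apply (CV_mult (fun _ => e)); [|exact Hz].
    intros eps Heps. exists 0%nat. intros n _. unfold R_dist.
    rewrite Rminus_diag, Rabs_R0. exact Heps. }
  apply (CV_plus (fun n => a * u n + b * v n)); [apply CV_plus|]; now apply Hs.
Qed.

Lemma Un_cv_ext_R (u v : nat -> R) l : (forall n, u n = v n) -> Un_cv u l -> Un_cv v l.
Proof.
  intros E H eps Heps. destruct (H eps Heps) as [N HN].
  exists N. intros n Hn. rewrite <- E. now apply HN.
Qed.

Lemma Un_cv_pow (u : nat -> R) l n : Un_cv u l -> Un_cv (fun m => u m ^ n) (l ^ n).
Proof.
  intros H. induction n as [|n IH]; cbn [pow].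
  - intros eps Heps. exists 0%nat. intros m _. unfold R_dist.
    rewrite Rminus_diag, Rabs_R0. exact Heps.
  - now apply CV_mult.
Qed.

Section Increments.
Variable x : R.
Hypothesis Hx : 1 <= x.

Let Hx0 : 0 < x.
Proof. lra. Qed.

Let pmf_ge0 k : 0 <= incr_pmf x k.
Proof. apply Rlt_le, incr_pmf_pos, Hx0. Qed.

Lemma pmf_mass_le M : zsum M (incr_pmf x) <= 1.
Proof.
  eapply Rle_trans; [|apply (proj1 (skellam_moment0 x Hx0) M)].
  apply Req_le, zsum_ext. intros; ring.
Qed.

Lemma pmf_mass_cv : Un_cv (fun M => zsum M (incr_pmf x)) 1.
Proof.
  eapply Un_cv_ext_R; [|apply (proj2 (skellam_moment0 x Hx0))].
  intros M. apply zsum_ext. intros; ring.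
Qed.

Lemma zsum_lin3 M (w f g h : Z -> R) a b c :
  zsum M (fun k => w k * (a * f k + b * g k + c * h k))
  = a * zsum M (fun k => w k * f k) + b * zsum M (fun k => w k * g k)
    + c * zsum M (fun k => w k * h k).
Proof.
  rewrite <- !zsum_scal, <- !zsum_plus. apply zsum_ext. intros; ring.
Qed.

Lemma chi_mean_cv : Un_cv (fun M => zsum M (fun k => incr_pmf x k * chi x k)) 0.
Proof.
  pose proof (Un_cv_lin3 _ _ _ (/ x) (-1) 0 _ _ _ (proj2 (skellam_moment2 x Hx0))
    (proj2 (skellam_moment0 x Hx0)) (proj2 (skellam_moment0 x Hx0))) as H.
  replace (/ x * x + -1 * 1 + 0 * 1) with 0 in H by (field; lra).
  eapply Un_cv_ext_R; [|exact H]. intros M. cbv beta.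
  rewrite <- zsum_lin3. apply zsum_ext. intros k _. unfold chi. field. lra.
Qed.

(** The exact variance is [(3 x^2 + x) / x^2 - 1 = 2 + / x]; the comparison is with the truncated
    mass because [Hvar] has this form. *)
Lemma chi_var_cv :
  Un_cv (fun M => zsum M (fun k => incr_pmf x k * chi x k ^ 2)
                  - (2 + / x) * zsum M (incr_pmf x)) 0.
Proof.
  pose proof (Un_cv_lin3 _ _ _ (/ x ^ 2) (- 2 / x) (- 1 - / x) _ _ _
    (proj2 (skellam_moment4 x Hx0)) (proj2 (skellam_moment2 x Hx0))
    (proj2 (skellam_moment0 x Hx0))) as H.
  replace (/ x ^ 2 * (3 * x ^ 2 + x) + - 2 / x * x + (- 1 - / x) * 1) with 0 in H
    by (field; lra).
  eapply Un_cv_ext_R; [|exact H]. intros M. cbv beta.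
  rewrite <- zsum_lin3, <- zsum_scal, <- zsum_minus.
  apply zsum_ext. intros k _. unfold chi. field. lra.
Qed.

Let Hix : 0 < / x <= 1.
Proof.
  split; [apply Rinv_0_lt_compat, Hx0|]. rewrite <- Rinv_1. apply Rinv_le_contravar; lra.
Qed.

(** [(u - 1)^2 <= u^2 + 1] for [u = k^2 / x], and the fourth moment over [x^2] is at most 4. The
    first and third absolute moments are bounded in the same way. *)
Lemma chi_second_moment M : zsum M (fun k => incr_pmf x k * chi x k ^ 2) <= 5.
Proof.
  apply Rle_trans with (zsum M (fun k =>
    incr_pmf x k * (/ x ^ 2 * IZR k ^ 4 + 1 * 1 + 0 * 1))).
  - apply zsum_le. intros k _. apply Rmult_le_compat_l; [apply pmf_ge0|].
    replace (/ x ^ 2 * IZR k ^ 4) with ((IZR k ^ 2 / x) ^ 2) by (field; lra). unfold chi.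
    assert (0 <= IZR k ^ 2 / x) by (apply Rle_mult_inv_pos; [apply pow2_ge_0|lra]).
    nra.
  - rewrite (zsum_lin3 M _ (fun k => IZR k ^ 4) (fun _ => 1) (fun _ => 1)).
    pose proof (proj1 (skellam_moment4 x Hx0) M) as H4.
    pose proof (proj1 (skellam_moment0 x Hx0) M) as H0.
    apply (Rmult_le_compat_l (/ x ^ 2)) in H4;
      [|apply Rlt_le, Rinv_0_lt_compat, pow_lt; lra].
    replace (/ x ^ 2 * (3 * x ^ 2 + x)) with (3 + / x) in H4 by (field; lra). lra.
Qed.

Lemma chi_abs_moment M : zsum M (fun k => incr_pmf x k * Rabs (chi x k)) <= 2.
Proof.
  apply Rle_trans with (zsum M (fun k =>
    incr_pmf x k * (/ x * IZR k ^ 2 + 1 * 1 + 0 * 1))).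
  - apply zsum_le. intros k _. apply Rmult_le_compat_l; [apply pmf_ge0|].
    replace (/ x * IZR k ^ 2) with (IZR k ^ 2 / x) by (field; lra). unfold chi.
    assert (0 <= IZR k ^ 2 / x) by (apply Rle_mult_inv_pos; [apply pow2_ge_0|lra]).
    apply Rabs_le. lra.
  - rewrite (zsum_lin3 M _ (fun k => IZR k ^ 2) (fun _ => 1) (fun _ => 1)).
    pose proof (proj1 (skellam_moment2 x Hx0) M) as H2.
    pose proof (proj1 (skellam_moment0 x Hx0) M) as H0.
    apply (Rmult_le_compat_l (/ x)) in H2; [|lra].
    rewrite Rinv_l in H2 by lra. lra.
Qed.

Lemma chi_third_moment M : zsum M (fun k => incr_pmf x k * Rabs (chi x k) ^ 3) <= 32.
Proof.
  apply Rle_trans with (zsum M (fun k =>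
    incr_pmf x k * (/ x ^ 3 * IZR k ^ 6 + 1 * 1 + 0 * 1))).
  - apply zsum_le. intros k _. apply Rmult_le_compat_l; [apply pmf_ge0|].
    replace (/ x ^ 3 * IZR k ^ 6) with ((IZR k ^ 2 / x) ^ 3) by (field; lra). unfold chi.
    assert (Hu : 0 <= IZR k ^ 2 / x) by (apply Rle_mult_inv_pos; [apply pow2_ge_0|lra]).
    set (u := IZR k ^ 2 / x) in *.
    assert (Hu3 : 0 <= u ^ 3) by now apply pow_le.
    destruct (Rle_lt_dec 1 u).
    + rewrite Rabs_pos_eq by lra.
      apply Rle_trans with (u ^ 3); [apply pow_incr; lra|lra].
    + rewrite Rabs_left by lra.
      apply Rle_trans with (1 ^ 3); [apply pow_incr; lra|lra].
  - rewrite (zsum_lin3 M _ (fun k => IZR k ^ 6) (fun _ => 1) (fun _ => 1)).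
    pose proof (skellam_moment6 x Hx0 M) as H6.
    pose proof (proj1 (skellam_moment0 x Hx0) M) as H0.
    apply (Rmult_le_compat_l (/ x ^ 3)) in H6;
      [|apply Rlt_le, Rinv_0_lt_compat, pow_lt; lra].
    replace (/ x ^ 3 * (15 * x ^ 3 + 15 * x ^ 2 + x)) with (15 + 15 * / x + / x * / x) in H6
      by (field; lra). nra.
Qed.

(** The term linear in [Rabs (IZR k)] sets the rate [/ sqrt x]. It is split by
    [2 |k| sqrt x <= k^2 + x], so only even moments are needed; the constant is [56 + 16 + 4]. *)
Lemma rem_bound_moment M :
  zsum M (fun k => incr_pmf x k * rem_bound x k) <= 76 / sqrt x.
Proof.
  set (q := sqrt x). assert (Hq : 1 <= q) by (rewrite <- sqrt_1; apply sqrt_le_1_alt, Hx).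
  assert (Hqq : q * q = x) by (apply sqrt_sqrt; lra).
  apply Rle_trans with (zsum M (fun k =>
    incr_pmf x k * (16 / x ^ 3 * IZR k ^ 4 + 2 / (x * q) * IZR k ^ 2 + (8 / x + 2 / q) * 1))).
  - apply zsum_le. intros k _. apply Rmult_le_compat_l; [apply pmf_ge0|].
    unfold rem_bound.
    assert (Hk : 4 * Rabs (IZR k) / x <= 2 / (x * q) * IZR k ^ 2 + 2 / q).
    { rewrite <- (pow2_abs (IZR k)). set (a := Rabs (IZR k)).
      apply (Rmult_le_reg_r (x * q)); [nra|].
      replace (4 * a / x * (x * q)) with (4 * a * q) by (field; lra).
      replace ((2 / (x * q) * a ^ 2 + 2 / q) * (x * q)) with (2 * a ^ 2 + 2 * x)
        by (field; lra).
      pose proof (pow2_ge_0 (a - q)). nra. }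
    unfold Rdiv in *. lra.
  - rewrite (zsum_lin3 M _ (fun k => IZR k ^ 4) (fun k => IZR k ^ 2) (fun _ => 1)).
    pose proof (proj1 (skellam_moment4 x Hx0) M) as H4.
    pose proof (proj1 (skellam_moment2 x Hx0) M) as H2.
    pose proof (proj1 (skellam_moment0 x Hx0) M) as H0.
    assert (Hp : forall c y, 0 < c -> 0 < y -> 0 <= c / y)
      by (intros; now apply Rlt_le, Rdiv_lt_0_compat).
    apply (Rmult_le_compat_l (16 / x ^ 3)) in H4; [|apply Hp; [lra|apply pow_lt; lra]].
    apply (Rmult_le_compat_l (2 / (x * q))) in H2; [|apply Hp; nra].
    apply (Rmult_le_compat_l (8 / x + 2 / q)) in H0;
      [|pose proof (Hp 8 x ltac:(lra) Hx0); pose proof (Hp 2 q ltac:(lra) ltac:(lra)); lra].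
    eapply Rle_trans; [apply Rplus_le_compat; [apply Rplus_le_compat; eassumption|exact H0]|].
    assert (Hiq : 0 < / q <= 1).
    { split; [apply Rinv_0_lt_compat; lra|]. rewrite <- Rinv_1. apply Rinv_le_contravar; lra. }
    rewrite <- Hqq.
    replace (16 / (q * q) ^ 3 * (3 * (q * q) ^ 2 + q * q) + 2 / (q * q * q) * (q * q)
             + (8 / (q * q) + 2 / q) * 1)
      with (56 * (/ q * / q) + 16 * (/ q * / q) ^ 2 + 4 * / q) by (field; lra).
    unfold Rdiv. assert (/ q * / q <= / q) by nra. assert (0 <= / q * / q) by nra. nra.
Qed.

End Increments.

Lemma taylor_of_lipschitz (f f1 : R -> R) L :
  (forall x, is_derive f x (f1 x)) ->
  (forall x y, Rabs (f1 x - f1 y) <= L * Rabs (x - y)) -> 0 <= L ->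
  forall a b, Rabs (f (a + b) - f a - b * f1 a) <= L * b ^ 2.
Proof.
  intros Hd HL HL0 a b.
  destruct (MVT_gen f a (a + b) f1) as [z [Hz E]].
  - intros; apply Hd.
  - intros y _. apply derivable_continuous_pt. exists (f1 y). apply is_derive_Reals, Hd.
  - rewrite E. replace (f1 z * (a + b - a) - b * f1 a) with (b * (f1 z - f1 a)) by ring.
    rewrite Rabs_mult, <- (pow2_abs b).
    assert (Hza : Rabs (z - a) <= Rabs b).
    { revert Hz. unfold Rmin, Rmax. destruct (Rle_dec a (a + b)); intros Hz;
        unfold Rabs; repeat destruct Rcase_abs; lra. }
    pose proof (HL z a) as H. pose proof (Rabs_pos b).
    apply (Rmult_le_compat_l L) in Hza; [|exact HL0].
    apply Rle_trans with (Rabs b * (L * Rabs b)); [|right; ring].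
    apply Rmult_le_compat_l; lra.
Qed.

(** [C] depends on the test function only and survives the limit in [T]; [M0] may depend on
    everything, since the window grows first. [38 = 32 + 2 * 3] combines the third and first moments
    of [chi] with [2 + / x <= 3], and [K1] weighs the variance mismatch. *)
Lemma normal_approx (Phi : R -> R) (HPhi : is_std_normal_cdf Phi) (c d : R) :
  0 < d ->
  exists C, 0 <= C /\
  forall x n t eta, 1 <= x -> 0 < t -> 0 < eta ->
  exists M0, forall M, (M0 <= M)%nat ->
  Rabs (walk (incr_pmf x) (chi x) M n (fun s => ramp c d (t * s)) 0 - ramp_mean Phi c d)
  <= C * (INR n * t ^ 3 + Rabs (1 - INR n * (2 + / x) * t ^ 2)) + eta.
Proof.
  intros Hd.
  destruct (stein_sol_bounds Phi HPhi c d Hd) as [K0 [K1 [L [HK0 [HK1 [HL [Hf [Hf1 Hlip]]]]]]]].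
  exists (38 * L + K1). split; [lra|].
  intros x n t eta Hx Ht Heta.
  assert (Hx0 : 0 < x) by lra.
  assert (Hix : 0 < / x <= 1).
  { split; [now apply Rinv_0_lt_compat|]. rewrite <- Rinv_1. apply Rinv_le_contravar; lra. }
  set (N := ramp_mean Phi c d).
  assert (HN : 0 <= N <= 1).
  { pose proof (ramp_mean_bounds Phi HPhi c d Hd). fold N in H.
    pose proof (cdf_ge0 Phi HPhi c). pose proof (cdf_le1 Phi HPhi (c + d)). lra. }
  set (B := INR n * (t * K0 + t ^ 2 * K1)).
  pose proof (pos_INR n) as Hn.
  assert (Ht2 : 0 < t ^ 2) by now apply pow_lt.
  assert (Ht3 : 0 < t ^ 3) by now apply pow_lt.
  assert (HB : 0 <= B).
  { apply Rmult_le_pos; [exact Hn|]. apply Rplus_le_le_0_compat; apply Rmult_le_pos; lra. }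
  (* Half of [eta] pays for the defects of the truncated mean and variance, the other half for the
     mass lost in [n] steps. *)
  set (delta := eta / (2 * (B + 1))).
  assert (Hdelta : 0 < delta) by (apply Rdiv_lt_0_compat; lra).
  assert (HdB : delta * B <= eta / 2).
  { replace (eta / 2) with (delta * (B + 1)) by (unfold delta; field; lra). nra. }
  destruct (chi_mean_cv x Hx delta Hdelta) as [M1 HM1].
  destruct (chi_var_cv x Hx delta Hdelta) as [M2 HM2].
  destruct (Un_cv_pow _ _ n (pmf_mass_cv x Hx) (eta / 2)) as [M3 HM3]; [lra|].
  exists (max M1 (max M2 M3)). intros M HM.
  specialize (HM1 M ltac:(lia)). specialize (HM2 M ltac:(lia)). specialize (HM3 M ltac:(lia)).
  unfold R_dist in *. rewrite Rminus_0_r in HM1, HM2. rewrite pow1 in HM3.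
  assert (Hw0 : forall k, 0 <= incr_pmf x k) by (intros; now apply Rlt_le, incr_pmf_pos).
  pose proof (pmf_mass_le x Hx M) as Hw1.
  set (f := stein_sol Phi c d) in *. set (f1 := stein_sol' Phi c d) in *.
  (* The Stein solution at the scale of the unnormalised sum, with its derivative. *)
  set (F := fun s => t * f (t * s)). set (F1 := fun s => t ^ 2 * f1 (t * s)).
  set (sig2 := 2 + / x).
  assert (Hstein : Rabs (walk (incr_pmf x) (chi x) M n
            (fun s => (s - 0) * F s - INR n * sig2 * F1 s) 0)
          <= INR n * (delta * (t * K0) + delta * (t ^ 2 * K1) + (t ^ 3 * L) * (32 + sig2 * 2))).
  { apply stein_walk; try assumption.
    - intros s. unfold F. rewrite Rabs_mult, Rabs_pos_eq by lra.
      apply Rmult_le_compat_l; [lra|apply Hf].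
    - intros s. unfold F1. rewrite Rabs_mult, Rabs_pos_eq by lra.
      apply Rmult_le_compat_l; [lra|apply Hf1].
    - apply Rmult_le_pos; lra.
    - unfold sig2. lra.
    - intros s y. unfold F, F1.
      replace (t * f (t * (s + y)) - t * f (t * s) - y * (t ^ 2 * f1 (t * s)))
        with (t * (f (t * s + t * y) - f (t * s) - (t * y) * f1 (t * s)))
        by (rewrite Rmult_plus_distr_l; ring).
      rewrite Rabs_mult, Rabs_pos_eq by lra.
      replace (t ^ 3 * L * y ^ 2) with (t * (L * (t * y) ^ 2)) by ring.
      apply Rmult_le_compat_l; [lra|].
      apply taylor_of_lipschitz; [|exact Hlip|exact HL].
      intros z. now apply stein_sol_derive.
    - intros s y. unfold F1.
      replace (t ^ 2 * f1 (t * (s + y)) - t ^ 2 * f1 (t * s))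
        with (t ^ 2 * (f1 (t * (s + y)) - f1 (t * s))) by ring.
      rewrite Rabs_mult, (Rabs_pos_eq (t ^ 2)) by lra.
      replace (t ^ 3 * L * Rabs y) with (t ^ 2 * (L * (t * Rabs y))) by ring.
      apply Rmult_le_compat_l; [lra|].
      replace (t * Rabs y) with (Rabs (t * (s + y) - t * s)); [apply Hlip|].
      replace (t * (s + y) - t * s) with (t * y) by ring.
      rewrite Rabs_mult, Rabs_pos_eq by lra. reflexivity.
    - now apply Rlt_le.
    - now apply Rlt_le.
    - now apply chi_abs_moment.
    - now apply chi_third_moment. }
  set (m := zsum M (incr_pmf x) ^ n) in *.
  set (u := walk (incr_pmf x) (chi x) M n (fun s => f1 (t * s)) 0).
  assert (Hu : Rabs u <= K1) by (apply walk_bound; [assumption..|intros; apply Hf1]).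
  set (v := walk (incr_pmf x) (chi x) M n
            (fun s => (s - 0) * F s - INR n * sig2 * F1 s) 0) in *.
  (* Stein's equation integrated along the walk; the constant [N] is weighted by the remaining mass
     [m]. *)
  assert (E : walk (incr_pmf x) (chi x) M n (fun s => ramp c d (t * s)) 0
              = (-1) * v + (1 - INR n * sig2 * t ^ 2) * u + N * m).
  { rewrite (walk_ext _ _ _ Hw0 _ _ (fun s => 1 * ((-1) * ((s - 0) * F s - INR n * sig2 * F1 s)
        + (1 - INR n * sig2 * t ^ 2) * f1 (t * s)) + 1 * N)).
    - rewrite (walk_lin _ _ _ n 1 1 (fun s => (-1) * ((s - 0) * F s - INR n * sig2 * F1 s)
        + (1 - INR n * sig2 * t ^ 2) * f1 (t * s)) (fun _ => N)).
      rewrite (walk_lin _ _ _ n (-1) (1 - INR n * sig2 * t ^ 2)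
        (fun s => (s - 0) * F s - INR n * sig2 * F1 s) (fun s => f1 (t * s))).
      rewrite walk_const. fold u v m. ring.
    - intros s. unfold F, F1, f1, stein_sol'. fold f N. ring. }
  rewrite E.
  replace (-1 * v + (1 - INR n * sig2 * t ^ 2) * u + N * m - N)
    with (- v + ((1 - INR n * sig2 * t ^ 2) * u + N * (m - 1))) by ring.
  eapply Rle_trans; [apply Rabs_triang|]. rewrite Rabs_Ropp.
  pose proof (Rabs_triang ((1 - INR n * sig2 * t ^ 2) * u) (N * (m - 1))) as Htri.
  rewrite !Rabs_mult, (Rabs_pos_eq N) in Htri by lra.
  pose proof (Rabs_pos (1 - INR n * sig2 * t ^ 2)) as Ha.
  set (a := Rabs (1 - INR n * sig2 * t ^ 2)) in *.
  assert (a * Rabs u <= a * K1) by now apply Rmult_le_compat_l.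
  assert (N * Rabs (m - 1) <= eta / 2).
  { pose proof (Rabs_pos (m - 1)). nra. }
  assert (Hk : INR n * (delta * (t * K0) + delta * (t ^ 2 * K1) + t ^ 3 * L * (32 + sig2 * 2))
               <= delta * B + 38 * L * (INR n * t ^ 3)).
  { unfold B, sig2. assert (0 <= INR n * (t ^ 3 * L)) by (repeat apply Rmult_le_pos; lra). nra. }
  assert (0 <= INR n * t ^ 3) by (apply Rmult_le_pos; lra).
  assert (0 <= L * a) by now apply Rmult_le_pos.
  assert (0 <= K1 * (INR n * t ^ 3)) by now apply Rmult_le_pos.
  nra.
Qed.

(** * The LAN expansion *)

(** Values in [[0, 1]] make the increment truncations increasing and bounded, hence convergent. The
    position truncations share their limit, so [obs_expect] takes its intended value. *)
Lemma obs_expect_cv theta T Delta g :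
  0 < theta * Delta -> (forall l, 0 <= g l <= 1) ->
  Un_cv (fun M => incr_expect (theta * Delta) (nobs T Delta) M 0 (fun l => g (0%Z :: l)))
    (obs_expect theta T Delta g).
Proof.
  intros Hx Hg. set (x := theta * Delta) in *. set (n := nobs T Delta).
  set (u := fun M => incr_expect x n M 0 (fun l => g (0%Z :: l))).
  assert (Hp : forall k, 0 <= incr_pmf x k) by (intros; now apply Rlt_le, incr_pmf_pos).
  assert (Hm : forall M, zsum M (incr_pmf x) <= 1).
  { intros M. eapply Rle_trans; [|apply (proj1 (skellam_moment0 x Hx) M)].
    apply Req_le, zsum_ext. intros; ring. }
  assert (Hgrow : Un_growing u).
  { intros M. apply incr_expect_mono; [exact Hp| |lia]. intros l. apply Hg. }
  assert (Hub : has_ub u).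
  { exists 1. intros y [M ->]. unfold u.
    eapply Rle_trans; [apply (incr_expect_le x Hp _ _ _ _ (fun _ => 1)); intros; apply Hg|].
    rewrite (incr_expect_walk x (fun _ => 0) M n (fun _ => 1) 0 0), walk_const.
    pose proof (walk_mass_pow (incr_pmf x) M Hp (Hm M) n). lra. }
  destruct (growing_cv u Hgrow Hub) as [P HP].
  replace (obs_expect theta T Delta g) with P; [exact HP|].
  symmetry. apply seq_lim_eq.
  apply (Un_cv_ext_R (fun M => pos_expect x n M 0 (fun l => g (0%Z :: l)))).
  - intros M. symmetry. apply obs_boxsum.
  - apply pos_expect_cv; [exact Hp| |exact HP]. intros l. apply Hg.
Qed.

Lemma Un_cv_le_eventually (u : nat -> R) l b M0 :
  Un_cv u l -> (forall M, (M0 <= M)%nat -> u M <= b) -> l <= b.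
Proof.
  intros Hu Hb. apply Rnot_lt_le. intros Hlt.
  destruct (Hu (l - b)) as [N HN]; [lra|].
  specialize (HN (max N M0) ltac:(lia)). specialize (Hb (max N M0) ltac:(lia)).
  unfold R_dist in HN. apply Rabs_def2 in HN. lra.
Qed.

Lemma Un_cv_ge_eventually (u : nat -> R) l b M0 :
  Un_cv u l -> (forall M, (M0 <= M)%nat -> b <= u M) -> b <= l.
Proof.
  intros Hu Hb. apply Rnot_lt_le. intros Hlt.
  destruct (Hu (b - l)) as [N HN]; [lra|].
  specialize (HN (max N M0) ltac:(lia)). specialize (Hb (max N M0) ltac:(lia)).
  unfold R_dist in HN. apply Rabs_def2 in HN. lra.
Qed.

(** With this scaling [h / 2] times the sum of [chi] is exactly [v] times the statistic. The value
    at the empty list is a dummy, as that list has mass zero. *)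
Definition chi_stat (x nu : R) (l : list Z) : R :=
  match l with
  | nil => 0
  | z :: l' => path_sum (chi x) z l' / sqrt (2 * nu)
  end.

(** The indicator of the half-line lies between the ramp that ends at [c] and the one that starts
    there; their Gaussian means lie between [Phi (c - d)] and [Phi (c + d)]. The auxiliary [eta] is
    arbitrary and drops out. *)
Lemma cdf_approx (Phi : R -> R) (HPhi : is_std_normal_cdf Phi) (c d : R) :
  0 < d ->
  exists C, 0 <= C /\
  forall theta T Delta (x := theta * Delta) (nu := T / Delta)
    (n := INR (nobs T Delta)) (t := / sqrt (2 * nu))
    (err := C * (n * t ^ 3 + Rabs (1 - n * (2 + / x) * t ^ 2))),
  1 <= x -> 0 < nu ->
  Phi (c - d) - err <= prob_le theta T Delta (chi_stat x nu) c <= Phi (c + d) + err.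
Proof.
  intros Hd.
  destruct (normal_approx Phi HPhi c d Hd) as [C1 [HC1 H1]].
  destruct (normal_approx Phi HPhi (c - d) d Hd) as [C2 [HC2 H2]].
  exists (C1 + C2). split; [lra|]. intros theta T Delta x nu n t err Hx Hnu.
  assert (Hs : 0 < sqrt (2 * nu)) by (apply sqrt_lt_R0; lra).
  assert (Ht : 0 < t) by now apply Rinv_0_lt_compat.
  assert (Hp : forall k, 0 <= incr_pmf x k) by (intros; apply Rlt_le, incr_pmf_pos; lra).
  set (a := n * t ^ 3 + Rabs (1 - n * (2 + / x) * t ^ 2)) in *.
  assert (Ha : 0 <= a).
  { unfold a. pose proof (Rabs_pos (1 - n * (2 + / x) * t ^ 2)).
    pose proof (pos_INR (nobs T Delta)). pose proof (pow_lt t 3 Ht).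
    assert (0 <= n * t ^ 3) by (apply Rmult_le_pos; [easy|lra]). lra. }
  set (g := fun l => if Rle_dec (chi_stat x nu l) c then 1 else 0).
  pose proof (obs_expect_cv theta T Delta g ltac:(fold x; lra)
    ltac:(intros l; unfold g; destruct Rle_dec; lra)) as HP.
  change (obs_expect theta T Delta g) with (prob_le theta T Delta (chi_stat x nu) c) in HP.
  fold x in HP.
  set (P := prob_le theta T Delta (chi_stat x nu) c) in *.
  pose proof (ramp_mean_bounds Phi HPhi c d Hd) as HN1.
  pose proof (ramp_mean_bounds Phi HPhi (c - d) d Hd) as HN2.
  replace (c - d + d) with c in HN2 by ring.
  assert (Hst : forall l, chi_stat x nu (0%Z :: l) = t * (0 + path_sum (chi x) 0 l))
    by (intros l; cbn [chi_stat]; unfold t, Rdiv; ring).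
  split.
  - apply Rle_plus_epsilon. intros eta Heta.
    destruct (H2 x (nobs T Delta) t eta Hx Ht Heta) as [M0 HM0].
    apply Rle_trans with (ramp_mean Phi (c - d) d - C2 * a - eta + eta);
      [unfold err; nra|]. apply Rplus_le_compat_r.
    apply (Un_cv_ge_eventually _ _ _ M0 HP). intros M HM.
    specialize (HM0 M HM). fold n a in HM0. apply Rabs_le_between in HM0.
    apply Rle_trans with (walk (incr_pmf x) (chi x) M (nobs T Delta)
                            (fun s => ramp (c - d) d (t * s)) 0); [lra|].
    rewrite <- (incr_expect_walk x (chi x) M (nobs T Delta) _ 0).
    apply incr_expect_le; [exact Hp|]. intros l _.
    unfold g. rewrite Hst. destruct Rle_dec as [Hle|Hgt].
    + apply ramp_bounds.
    + right. apply ramp_right; lra.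
  - apply Rle_plus_epsilon. intros eta Heta.
    destruct (H1 x (nobs T Delta) t eta Hx Ht Heta) as [M0 HM0].
    apply Rle_trans with (ramp_mean Phi c d + C1 * a + eta); [|unfold err; nra].
    apply (Un_cv_le_eventually _ _ _ M0 HP). intros M HM.
    specialize (HM0 M HM). fold n a in HM0. apply Rabs_le_between in HM0.
    apply Rle_trans with (walk (incr_pmf x) (chi x) M (nobs T Delta)
                            (fun s => ramp c d (t * s)) 0); [|lra].
    rewrite <- (incr_expect_walk x (chi x) M (nobs T Delta) _ 0).
    apply incr_expect_le; [exact Hp|]. intros l _.
    unfold g. rewrite Hst. destruct Rle_dec as [Hle|Hgt].
    + right. symmetry. now apply ramp_left.
    + apply ramp_bounds.
Qed.

Lemma path_prod_pos x z l : 0 < x -> 0 < path_prod x z l.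
Proof.
  intros Hx. revert z. induction l as [|y l IH]; intros z; cbn [path_prod]; [lra|].
  apply Rmult_lt_0_compat; [now apply incr_pmf_pos|apply IH].
Qed.

Lemma path_log_ratio x h z l :
  0 < x -> Rabs h <= / 2 ->
  Rabs (ln (path_prod (x * (1 + h)) z l / path_prod x z l)
        + INR (length l) * (ln (1 + h) / 2)
        - (path_sum (chi x) z l + INR (length l)) * (h / (1 + h)) / 2)
  <= Rabs h * path_sum (rem_bound x) z l.
Proof.
  intros Hx Hh.
  assert (Hy : 0 < x * (1 + h)).
  { apply Rabs_le_between in Hh. apply Rmult_lt_0_compat; lra. }
  revert z. induction l as [|y l IH]; intros z.
  - cbn. replace (1 / 1) with 1 by field. rewrite ln_1.
    match goal with |- Rabs ?e <= _ => replace e with 0 by (unfold Rdiv; ring) end.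
    rewrite Rabs_R0. lra.
  - pose proof (log_ratio (y - z) x h Hx Hh) as H1. specialize (IH y).
    pose proof (path_prod_pos _ y l Hx). pose proof (path_prod_pos _ y l Hy).
    pose proof (incr_pmf_pos _ (y - z)%Z Hx). pose proof (incr_pmf_pos _ (y - z)%Z Hy).
    change (length (y :: l)) with (S (length l)). rewrite S_INR.
    cbn [path_prod path_sum].
    rewrite ln_div in IH |- * by (try apply Rmult_lt_0_compat; assumption).
    rewrite !ln_mult by assumption.
    replace (IZR (y - z) ^ 2 / x) with (chi x (y - z)%Z + 1) in H1 by (unfold chi; ring).
    rewrite (Rmult_plus_distr_l (Rabs h)).
    eapply Rle_trans; [|apply Rplus_le_compat; [exact H1|exact IH]].
    eapply Rle_trans; [|apply Rabs_triang].
    right. apply f_equal. unfold Rdiv. ring.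
Qed.

(** The derivative [y^2 (2 + y) / (1 + y)^2] makes the expression cubic at zero. Multiplied by
    [n / 2], the term [h ^ 2 / 2] is the source of [v ^ 2 / 2] in the expansion. *)
Lemma log_expansion h :
  Rabs h <= / 2 -> Rabs (h / (1 + h) - ln (1 + h) + h ^ 2 / 2) <= 10 * Rabs h ^ 3.
Proof.
  intros Hh.
  set (f := fun y => y / (1 + y) - ln (1 + y) + y ^ 2 / 2).
  destruct (MVT_gen f 0 h (fun y => y ^ 2 * (2 + y) / (1 + y) ^ 2)) as [z [Hz E]].
  - intros y Hy. assert (- / 2 <= y).
    { apply Rabs_le_between in Hh. revert Hy. unfold Rmin, Rmax.
      destruct Rle_dec; lra. }
    unfold f. auto_derive; [lra|]. field. lra.
  - intros y Hy. assert (- / 2 <= y).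
    { apply Rabs_le_between in Hh. revert Hy. unfold Rmin, Rmax.
      destruct Rle_dec; lra. }
    apply continuity_pt_filterlim, ex_derive_R_continuous. unfold f.
    auto_derive. lra.
  - replace (h / (1 + h) - ln (1 + h) + h ^ 2 / 2) with (f h - f 0).
    2:{ unfold f. rewrite Rplus_0_r, ln_1. field.
        apply Rabs_le_between in Hh. lra. }
    rewrite E, Rminus_0_r, Rabs_mult.
    assert (Hzh : Rabs z <= Rabs h).
    { revert Hz. unfold Rmin, Rmax. destruct Rle_dec; intros Hz;
        unfold Rabs; repeat destruct Rcase_abs; lra. }
    assert (Hz2 : - / 2 <= z <= / 2) by (apply Rabs_le_between; lra).
    replace (10 * Rabs h ^ 3) with (10 * Rabs h ^ 2 * Rabs h) by ring.
    apply Rmult_le_compat_r; [apply Rabs_pos|].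
    assert (H1z : 0 < (1 + z) ^ 2) by (apply pow_lt; lra).
    rewrite Rabs_pos_eq.
    + apply Rle_trans with (10 * Rabs z ^ 2).
      * rewrite pow2_abs. apply (Rmult_le_reg_r ((1 + z) ^ 2)); [exact H1z|].
        unfold Rdiv. rewrite Rmult_assoc, Rinv_l by lra.
        assert (2 + z <= 10 * (1 + z) ^ 2) by nra.
        pose proof (pow2_ge_0 z). nra.
      * apply Rmult_le_compat_l; [lra|]. apply pow_incr. split; [apply Rabs_pos|exact Hzh].
    + apply Rle_mult_inv_pos; [|exact H1z].
      apply Rmult_le_pos; [apply pow2_ge_0|lra].
Qed.

Lemma nobs_bounds T Delta :
  0 < T / Delta -> INR (nobs T Delta) <= T / Delta < INR (nobs T Delta) + 1.
Proof.
  intros H. unfold nobs. destruct (base_Int_part (T / Delta)) as [H1 H2].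
  assert (Hz : (0 <= Int_part (T / Delta))%Z).
  { apply Z.lt_succ_r, lt_IZR. rewrite succ_IZR. lra. }
  rewrite INR_IZR_INZ, Z2Nat.id by exact Hz. lra.
Qed.

Lemma pow_one_plus_le n : (1 + / (INR n + 1)) ^ n <= 3.
Proof.
  pose proof (pos_INR n) as Hn. set (d := / (INR n + 1)).
  assert (Hd : 0 < d) by (apply Rinv_0_lt_compat; lra).
  assert (H : forall m, (1 + d) ^ m <= exp (INR m * d)).
  { induction m as [|m IH].
    - simpl. rewrite Rmult_0_l, exp_0. lra.
    - rewrite S_INR. replace ((INR m + 1) * d) with (d + INR m * d) by ring.
      rewrite exp_plus. cbn [pow].
      apply Rmult_le_compat; [lra|apply pow_le; lra|apply exp_ineq1_le|exact IH]. }
  eapply Rle_trans; [apply H|]. eapply Rle_trans; [|apply exp_le_3].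
  apply Rlt_le, exp_increasing. apply (Rmult_lt_reg_r (INR n + 1)); [lra|].
  unfold d. rewrite Rmult_assoc, Rinv_l by lra. lra.
Qed.

Lemma path_sum_ge0 b z l : (forall k, 0 <= b k) -> 0 <= path_sum b z l.
Proof.
  intros Hb. revert z. induction l as [|y l IH]; intros z; cbn [path_sum]; [lra|].
  pose proof (Hb (y - z)%Z). pose proof (IH y). lra.
Qed.

Lemma rem_bound_ge0 x k : 0 < x -> 0 <= rem_bound x k.
Proof.
  intros Hx. unfold rem_bound. pose proof (Rabs_pos (IZR k)).
  apply Rplus_le_le_0_compat; apply Rle_mult_inv_pos; try lra.
  - replace (IZR k ^ 4) with ((IZR k ^ 2) ^ 2) by ring.
    pose proof (pow2_ge_0 (IZR k ^ 2)). lra.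
  - now apply pow_lt.
Qed.

(** * The remainder of the log-likelihood expansion *)

Section Remainder.
Variables (theta T Delta v : R).
Hypothesis Htheta : 0 < theta.
Let x := theta * Delta.
Let nu := T / Delta.
Let n := nobs T Delta.
Let q := sqrt nu.
Let h := v * sqrt 2 / q.
Hypothesis Hx : 1 <= x.
Hypothesis Hnu : 1 <= nu.
Hypothesis Hh : Rabs h <= / 2.

Let theta' := theta + v / sqrt ((T / Delta) / (2 * theta ^ 2)).
Let r (l : list Z) :=
  ln (lik_ratio theta' theta T Delta l) - v * chi_stat x nu l + v ^ 2 / 2.

Let Hq : 1 <= q.
Proof. unfold q. rewrite <- sqrt_1. now apply sqrt_le_1_alt. Qed.

Let Hqq : q * q = nu.
Proof. apply sqrt_sqrt. lra. Qed.

Let Hs2 : sqrt 2 * sqrt 2 = 2 /\ 0 < sqrt 2.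
Proof. split; [apply sqrt_sqrt|apply sqrt_lt_R0]; lra. Qed.

Let Hn : INR n <= nu < INR n + 1.
Proof. apply nobs_bounds. fold nu. lra. Qed.

(** One over the root of the normalisation is [theta * sqrt 2 / sqrt nu], so the relative change of
    intensity is [h], free of [theta]. *)
Lemma alternative_intensity : theta' * Delta = x * (1 + h).
Proof.
  unfold theta', x, h. fold nu. destruct Hs2 as [Hs Hs0].
  assert (E : sqrt (nu / (2 * theta ^ 2)) = q / (sqrt 2 * theta)).
  { apply sqrt_lem_1.
    - apply Rle_mult_inv_pos; [lra|]. pose proof (pow_lt theta 2 Htheta). lra.
    - apply Rle_mult_inv_pos; [lra|]. now apply Rmult_lt_0_compat.
    - replace (q / (sqrt 2 * theta) * (q / (sqrt 2 * theta)))
        with ((q * q) / ((sqrt 2 * sqrt 2) * theta ^ 2)) by (field; lra).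
      now rewrite Hs, Hqq. }
  rewrite E. field. repeat split; lra.
Qed.

(** An exact decomposition into four errors: the cubic one of [log_expansion], the floor of [nu],
    the replacement of [h / (1 + h)] by [h] in the linear term, and the Bessel remainder. The first
    two are deterministic. *)
Lemma remainder_pointwise l :
  length l = n ->
  Rabs (r (0%Z :: l))
  <= 5 * INR n * Rabs h ^ 3 + v ^ 2 / (2 * nu)
     + (2 * Rabs h * Rabs v * Rabs (path_sum (chi x) 0 l) / sqrt (2 * nu)
        + Rabs h * path_sum (rem_bound x) 0 l).
Proof.
  intros Hl. destruct Hs2 as [Hs Hs0].
  pose proof (path_log_ratio x h 0 l ltac:(lra) Hh) as HR. rewrite Hl in HR.
  pose proof (log_expansion h Hh) as HE.
  unfold r, lik_ratio, obs_pmf, chi_stat.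
  destruct (Z.eq_dec 0 0); [|easy]. fold n.
  destruct (Nat.eq_dec (length l) n); [|easy].
  rewrite alternative_intensity. fold x.
  set (S := path_sum (chi x) 0 l) in *. set (B := path_sum (rem_bound x) 0 l) in *.
  set (LL := ln _) in *.
  set (e1 := h / (1 + h) - ln (1 + h) + h ^ 2 / 2) in *.
  set (e2 := LL + INR n * (ln (1 + h) / 2) - (S + INR n) * (h / (1 + h)) / 2) in *.
  assert (Hh2 : - / 2 <= h <= / 2) by now apply Rabs_le_between.
  assert (Hs2n : sqrt (2 * nu) = sqrt 2 * q).
  { unfold q. apply sqrt_mult; lra. }
  assert (Hhs : h * sqrt (2 * nu) = 2 * v).
  { rewrite Hs2n. unfold h. transitivity ((sqrt 2 * sqrt 2) * v); [field; lra|].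
    rewrite Hs. ring. }
  assert (Hsn0 : 0 < sqrt (2 * nu)) by (apply sqrt_lt_R0; lra).
  assert (Hh2n : h ^ 2 = 2 * v ^ 2 / nu).
  { rewrite <- Hqq, <- Hs. unfold h. field. lra. }
  assert (E : LL - v * (S / sqrt (2 * nu)) + v ^ 2 / 2
    = INR n / 2 * e1 + v ^ 2 / 2 * (1 - INR n / nu)
      + (- (h * v * S / sqrt (2 * nu)) * / (1 + h) + e2)).
  { assert (E1 : INR n / 2 * e1
      = INR n / 2 * (h / (1 + h)) - INR n / 2 * ln (1 + h) + INR n * v ^ 2 / (2 * nu))
      by (unfold e1; rewrite Hh2n; field; lra).
    rewrite E1. unfold e2.
    assert (E2 : S * (h / (1 + h)) / 2 = v * S / sqrt (2 * nu) * / (1 + h)).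
    { replace v with (h * sqrt (2 * nu) / 2) by (rewrite Hhs; field). field. lra. }
    replace ((S + INR n) * (h / (1 + h)) / 2)
      with (S * (h / (1 + h)) / 2 + INR n / 2 * (h / (1 + h))) by (field; lra).
    rewrite E2. field. lra. }
  rewrite E.
  assert (H1 : Rabs (INR n / 2 * e1) <= 5 * INR n * Rabs h ^ 3).
  { pose proof (pos_INR n). rewrite Rabs_mult, Rabs_pos_eq by lra. nra. }
  assert (H2 : Rabs (v ^ 2 / 2 * (1 - INR n / nu)) <= v ^ 2 / (2 * nu)).
  { replace (v ^ 2 / 2 * (1 - INR n / nu)) with ((nu - INR n) * (v ^ 2 / (2 * nu)))
      by (field; lra).
    assert (0 <= v ^ 2 / (2 * nu)) by (apply Rle_mult_inv_pos; [apply pow2_ge_0|lra]).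
    rewrite Rabs_pos_eq; [nra|]. apply Rmult_le_pos; lra. }
  assert (H3 : Rabs (- (h * v * S / sqrt (2 * nu)) * / (1 + h))
               <= 2 * Rabs h * Rabs v * Rabs S / sqrt (2 * nu)).
  { unfold Rdiv.
    assert (Hih : 0 < / (1 + h) <= 2).
    { split; [apply Rinv_0_lt_compat; lra|]. rewrite <- (Rinv_inv 2).
      apply Rinv_le_contravar; lra. }
    rewrite Rabs_mult, Rabs_Ropp, (Rabs_pos_eq (/ (1 + h))) by lra.
    rewrite !Rabs_mult, (Rabs_pos_eq (/ sqrt (2 * nu)))
      by (apply Rlt_le, Rinv_0_lt_compat, Hsn0).
    pose proof (Rinv_0_lt_compat _ Hsn0) as Hi.
    assert (0 <= Rabs h * Rabs v * Rabs S * / sqrt (2 * nu))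
      by (repeat apply Rmult_le_pos; try apply Rabs_pos; lra).
    nra. }
  eapply Rle_trans; [apply Rabs_triang|].
  pose proof (Rabs_triang (INR n / 2 * e1) (v ^ 2 / 2 * (1 - INR n / nu))).
  pose proof (Rabs_triang (- (h * v * S / sqrt (2 * nu)) * / (1 + h)) e2).
  lra.
Qed.

(** The deterministic errors use a third of [eps]; Chebyshev's inequality handles the sum of [chi]
    and Markov's the sum of [rem_bound], each at level [eps / 3]. *)
Lemma remainder_prob eps :
  0 < eps ->
  5 * INR n * Rabs h ^ 3 + v ^ 2 / (2 * nu) <= eps / 3 ->
  0 <= prob_abs_gt theta T Delta r eps
    <= 324 * h ^ 2 * v ^ 2 / eps ^ 2 + 228 * Rabs h * INR n / (eps * sqrt x).
Proof.
  intros Heps Hdet.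
  set (g := fun l => if Rlt_dec eps (Rabs (r l)) then 1 else 0).
  assert (Hg : forall l, 0 <= g l <= 1) by (intros l; unfold g; destruct Rlt_dec; lra).
  pose proof (obs_expect_cv theta T Delta g ltac:(fold x; lra) Hg) as HP.
  change (obs_expect theta T Delta g) with (prob_abs_gt theta T Delta r eps) in HP.
  fold x n in HP.
  assert (Hp : forall k, 0 <= incr_pmf x k) by (intros; apply Rlt_le, incr_pmf_pos; lra).
  split.
  { apply (Un_cv_ge_eventually _ _ _ 0 HP). intros M _.
    apply incr_expect_ge0; [exact Hp|]. intros l. apply Hg. }
  (* With the truncated mean below this [d], the factor [(1 + d) ^ n] in the second moment stays
     below 3. *)
  set (d := / (INR n + 1)). pose proof (pos_INR n) as Hn0.
  assert (Hd : 0 < d <= 1).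
  { unfold d. split; [apply Rinv_0_lt_compat; lra|].
    rewrite <- Rinv_1 at 2. apply Rinv_le_contravar; lra. }
  destruct (chi_mean_cv x Hx d ltac:(lra)) as [M0 HM0].
  apply (Un_cv_le_eventually _ _ _ M0 HP). intros M HM.
  specialize (HM0 M HM). unfold R_dist in HM0. rewrite Rminus_0_r in HM0.
  set (sn := sqrt (2 * nu)).
  assert (Hsn : sn * sn = 2 * nu) by (apply sqrt_sqrt; lra).
  assert (Hsn0 : 0 < sn) by (apply sqrt_lt_R0; lra).
  (* [a * S ^ 2] is the squared bound on the linear-term error over [eps / 3], and [b * B] the
     Bessel remainder over [eps / 3]; together they dominate the indicator. *)
  set (a := 18 * h ^ 2 * v ^ 2 / (nu * eps ^ 2)). set (b := 3 * Rabs h / eps).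
  assert (Ha : 0 <= a).
  { apply Rle_mult_inv_pos.
    - pose proof (pow2_ge_0 h). pose proof (pow2_ge_0 v).
      apply Rmult_le_pos; lra.
    - apply Rmult_lt_0_compat; [lra|now apply pow_lt]. }
  assert (Hb : 0 <= b).
  { apply Rle_mult_inv_pos; [pose proof (Rabs_pos h); lra|exact Heps]. }
  apply Rle_trans with (incr_expect x n M 0 (fun l =>
      a * (0 + path_sum (chi x) 0 l) ^ 2 + b * (0 + path_sum (rem_bound x) 0 l))).
  { apply incr_expect_le; [exact Hp|]. intros l Hl.
    pose proof (remainder_pointwise l Hl) as Hr. fold sn in Hr.
    rewrite !Rplus_0_l.
    set (S := path_sum (chi x) 0 l) in *.
    assert (HB : 0 <= path_sum (rem_bound x) 0 l)
      by (apply path_sum_ge0; intros; apply rem_bound_ge0; lra).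
    set (B := path_sum (rem_bound x) 0 l) in *.
    assert (HaS : 0 <= a * S ^ 2) by (apply Rmult_le_pos; [exact Ha|apply pow2_ge_0]).
    assert (HbB : 0 <= b * B) by now apply Rmult_le_pos.
    unfold g. destruct Rlt_dec as [Hlt|]; [|lra].
    assert (Hor : eps / 3 < 2 * Rabs h * Rabs v * Rabs S / sn \/ eps / 3 < Rabs h * B) by lra.
    destruct Hor as [H1|H1].
    - assert (1 <= a * S ^ 2); [|lra].
      replace (a * S ^ 2) with ((3 / eps * (2 * Rabs h * Rabs v * Rabs S / sn)) ^ 2).
      + rewrite <- (pow1 2). apply pow_incr. split; [lra|].
        apply (Rmult_lt_compat_l (3 / eps)) in H1; [|apply Rdiv_lt_0_compat; lra].
        replace (3 / eps * (eps / 3)) with 1 in H1 by (field; lra). lra.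
      + unfold a. rewrite <- (pow2_abs h), <- (pow2_abs v), <- (pow2_abs S).
        replace nu with (sn * sn / 2) by lra. field. lra.
    - assert (1 <= b * B); [|lra]. unfold b.
      apply (Rmult_lt_compat_l (3 / eps)) in H1; [|apply Rdiv_lt_0_compat; lra].
      replace (3 / eps * (eps / 3)) with 1 in H1 by (field; lra).
      replace (3 * Rabs h / eps * B) with (3 / eps * (Rabs h * B)) by (field; lra). lra. }
  rewrite (incr_expect_lin x n M 0 a b (fun l => (0 + path_sum (chi x) 0 l) ^ 2)
             (fun l => 0 + path_sum (rem_bound x) 0 l)).
  rewrite (incr_expect_walk x (chi x) M n (fun s => s ^ 2) 0 0).
  rewrite (incr_expect_walk x (rem_bound x) M n (fun s => s) 0 0).
  pose proof (pmf_mass_le x Hx M) as Hm.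
  pose proof (walk_second_moment (incr_pmf x) (chi x) M Hp Hm n d 5 0 ltac:(lra) ltac:(lra)
    (Rlt_le _ _ HM0) (chi_second_moment x Hx M)) as W2.
  assert (Hsx : 0 < sqrt x) by (apply sqrt_lt_R0; lra).
  pose proof (walk_mean (incr_pmf x) (rem_bound x) M Hp Hm n (76 / sqrt x) 0 ltac:(lra)
    ltac:(apply Rlt_le, Rdiv_lt_0_compat; lra)
    ltac:(intros; apply rem_bound_ge0; lra) (rem_bound_moment x Hx M)) as W1.
  assert (W2' : walk (incr_pmf x) (chi x) M n (fun s => s ^ 2) 0 <= 18 * nu).
  { eapply Rle_trans; [exact W2|].
    replace (18 * nu) with (3 * (0 ^ 2 + nu * 6)) by ring.
    pose proof (pow_one_plus_le n) as H3. fold d in H3.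
    apply Rmult_le_compat; [apply pow_le; lra| |exact H3|].
    - assert (0 <= INR n * (d + 5)) by (apply Rmult_le_pos; lra). simpl; lra.
    - assert (INR n * (d + 5) <= nu * 6) by (apply Rmult_le_compat; lra). simpl; lra. }
  apply (Rmult_le_compat_l a) in W2'; [|exact Ha].
  apply (Rmult_le_compat_l b) in W1; [|exact Hb].
  replace (a * (18 * nu)) with (324 * h ^ 2 * v ^ 2 / eps ^ 2) in W2'
    by (unfold a; field; lra).
  replace (b * (0 + INR n * (76 / sqrt x))) with (228 * Rabs h * INR n / (eps * sqrt x)) in W1
    by (unfold b; field; lra).
  lra.
Qed.

End Remainder.

(** * Asymptotic regime and conclusion *)

(* The rate assumption gives [T / Delta < Delta ^ (1/4)] eventually. *)
Lemma regime (Delta : R -> R) theta eta :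
  0 < theta -> 0 < eta ->
  diverges_at_infty Delta ->
  diverges_at_infty (fun T => T / Delta T) ->
  tends_at_infty
     (fun T => (T / Rpower (Delta T) (5 / 4))
               / Rpower (ln (T / Delta T)) (- (1 / 4))) 0 ->
  exists T0, forall T, T >= T0 ->
    1 <= theta * Delta T /\ 1 <= T / Delta T /\
    / sqrt (T / Delta T) <= eta /\
    sqrt (T / Delta T) / sqrt (theta * Delta T) <= eta.
Proof.
  intros Hth Heta HD HTD Hrate.
  (* The 3 ensures [ln nu >= 1]; the two inverses serve the third and the fourth conclusion. *)
  set (A := 3 + / eta ^ 2 + / (theta * eta ^ 2)).
  assert (He2 : 0 < eta ^ 2) by now apply pow_lt.
  pose proof (Rinv_0_lt_compat _ He2) as Hi1.
  pose proof (Rinv_0_lt_compat _ (Rmult_lt_0_compat _ _ Hth He2)) as Hi2.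
  destruct (HD (/ theta)) as [T1 H1]. destruct (HTD A) as [T2 H2].
  destruct (Hrate 1 ltac:(lra)) as [T3 H3].
  exists (Rmax T1 (Rmax T2 T3)). intros T HT.
  pose proof (Rmax_l T1 (Rmax T2 T3)). pose proof (Rmax_r T1 (Rmax T2 T3)).
  pose proof (Rmax_l T2 T3). pose proof (Rmax_r T2 T3).
  specialize (H1 T ltac:(lra)). specialize (H2 T ltac:(lra)). specialize (H3 T ltac:(lra)).
  set (D := Delta T) in *. set (nu := T / D) in *.
  pose proof (Rinv_0_lt_compat _ Hth) as Hith.
  assert (HD0 : 0 < D) by lra.
  assert (Hx : 1 <= theta * D).
  { apply (Rmult_lt_compat_l theta) in H1; [|exact Hth]. rewrite Rinv_r in H1 by lra. lra. }
  assert (Hnu : 3 <= nu) by (unfold A in H2; lra).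
  assert (Hln : 1 <= ln nu).
  { rewrite <- (ln_exp 1). apply ln_le; [apply exp_pos|]. pose proof exp_le_3. lra. }
  assert (Hfourth : nu ^ 4 < D).
  { rewrite Rminus_0_r in H3. apply Rabs_def2 in H3. destruct H3 as [H3 _].
    (* With [p] the fourth root of [Delta], the rate condition reads
       [nu / p < Rpower (ln nu) (- (1 / 4))], whose right side is at most one. *)
    set (p := Rpower D (/ 4)).
    assert (Hp : 0 < p) by apply exp_pos.
    assert (Hp4 : p ^ 4 = D).
    { unfold p. rewrite <- (Rpower_pow 4) by apply exp_pos. rewrite Rpower_mult.
      replace (/ 4 * INR 4) with 1 by (simpl; field). now apply Rpower_1. }
    assert (Hp5 : Rpower D (5 / 4) = D * p).
    { unfold p. rewrite <- (Rpower_1 D) at 2 by exact HD0. rewrite <- Rpower_plus.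
      f_equal. field. }
    assert (HlnP : Rpower (ln nu) (- (1 / 4)) <= 1).
    { apply Rle_trans with (Rpower (ln nu) 0); [apply Rle_Rpower; lra|].
      rewrite Rpower_O; lra. }
    assert (HlnP0 : 0 < Rpower (ln nu) (- (1 / 4))) by apply exp_pos.
    assert (Hnup : nu < p).
    { rewrite Hp5 in H3. replace (T / (D * p)) with (nu / p) in H3 by (unfold nu; field; lra).
      assert (E : nu = nu / p / Rpower (ln nu) (- (1 / 4)) * (p * Rpower (ln nu) (- (1 / 4))))
        by (field; lra).
      rewrite E. apply Rlt_le_trans with (1 * (p * Rpower (ln nu) (- (1 / 4)))).
      - apply Rmult_lt_compat_r; [now apply Rmult_lt_0_compat|exact H3].
      - nra. }
    rewrite <- Hp4. assert (nu * nu < p * p) by nra. nra. }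
  repeat split; try assumption; try lra.
  - rewrite <- (Rinv_inv eta). apply Rinv_le_contravar; [now apply Rinv_0_lt_compat|].
    rewrite <- (sqrt_pow2 (/ eta)) by (apply Rlt_le, Rinv_0_lt_compat, Heta).
    apply sqrt_le_1_alt. rewrite pow_inv. unfold A in H2. lra.
  - rewrite <- sqrt_div by lra. rewrite <- (sqrt_pow2 eta) by lra.
    apply sqrt_le_1_alt.
    apply (Rmult_le_reg_r (theta * D)); [lra|].
    unfold Rdiv. rewrite Rmult_assoc, Rinv_l by lra.
    (* The goal is [nu <= eta^2 theta D]; as [D > nu^4 >= nu^2], it follows from
       [1 <= eta^2 theta nu]. *)
    assert (Hn2 : / (theta * eta ^ 2) <= nu) by (unfold A in H2; lra).
    assert (Hn3 : 1 <= eta ^ 2 * theta * nu).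
    { apply (Rmult_le_compat_l (theta * eta ^ 2)) in Hn2; [|nra].
      rewrite Rinv_r in Hn2 by nra. lra. }
    assert (1 <= nu * nu) by nra.
    assert (nu * nu <= nu ^ 4)
      by (replace (nu ^ 4) with ((nu * nu) * (nu * nu)) by ring; nra).
    assert (0 < eta ^ 2 * theta) by nra.
    assert (1 * nu <= eta ^ 2 * theta * nu * nu) by (apply Rmult_le_compat_r; lra).
    assert (eta ^ 2 * theta * (nu * nu) <= eta ^ 2 * theta * D)
      by (apply Rmult_le_compat_l; lra).
    lra.
Qed.

(** Several smallness conditions are met by a single [eta], the reciprocal of the sum of their
    constants. *)
Lemma inv_le_self_bounds a b c eta :
  0 <= a -> 0 <= b -> 0 <= c -> eta = / (1 + a + b + c) ->
  0 < eta <= 1 /\ a * eta <= 1 /\ b * eta <= 1 /\ c * eta < 1.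
Proof.
  intros Ha Hb Hc ->.
  assert (H : 0 < / (1 + a + b + c)) by (apply Rinv_0_lt_compat; lra).
  assert (E : (1 + a + b + c) * / (1 + a + b + c) = 1) by (apply Rinv_r; lra).
  set (e := / (1 + a + b + c)) in *.
  repeat split; nra.
Qed.

Section Asymptotics.
Variables (Delta : R -> R) (theta : R).
Hypothesis Htheta : 0 < theta.
Hypothesis Hreg : forall eta, 0 < eta -> exists T0, forall T, T >= T0 ->
    1 <= theta * Delta T /\ 1 <= T / Delta T /\
    / sqrt (T / Delta T) <= eta /\
    sqrt (T / Delta T) / sqrt (theta * Delta T) <= eta.

(** [gauss <= 1] makes [Phi] 1-Lipschitz, so smoothing at width [eps / 4] costs [eps / 4]. The error
    of [cdf_approx] is at most [3 * eta] times [C]: one [eta] from the cubic term, two from the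
    variance, where the floor contributes [/ nu] and the kurtosis [/ x]. *)
Lemma chi_stat_normal :
  conv_std_normal theta Delta (fun T => chi_stat (theta * Delta T) (T / Delta T)).
Proof.
  intros Phi HPhi c eps Heps.
  set (d := eps / 4).
  destruct (cdf_approx Phi HPhi c d ltac:(unfold d; lra)) as [C [HC H]].
  set (eta := / (1 + 0 + 0 + 12 * C / eps)).
  assert (HCe : 0 <= 12 * C / eps) by (apply Rle_mult_inv_pos; lra).
  destruct (inv_le_self_bounds 0 0 (12 * C / eps) eta) as [Heta [_ [_ Heta3]]];
    [lra|lra|exact HCe|reflexivity|].
  assert (HCeta : C * (3 * eta) < eps / 4).
  { apply (Rmult_lt_compat_l (eps / 4)) in Heta3; [|lra].
    replace (eps / 4 * (12 * C / eps * eta)) with (C * (3 * eta)) in Heta3 by (field; lra).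
    lra. }
  destruct (Hreg eta ltac:(lra)) as [T0 HT0]. exists T0. intros T HT.
  destruct (HT0 T HT) as [Hx [Hnu [Hq Hqx]]].
  specialize (H theta T (Delta T)). cbv zeta in H. specialize (H Hx ltac:(lra)).
  pose proof (nobs_bounds T (Delta T) ltac:(lra)) as Hn.
  set (nu := T / Delta T) in *. set (x := theta * Delta T) in *.
  set (n := INR (nobs T (Delta T))) in *.
  set (q := sqrt nu) in *. set (s := sqrt (2 * nu)) in *.
  assert (Hq1 : 1 <= q) by (unfold q; rewrite <- sqrt_1; now apply sqrt_le_1_alt).
  assert (Hqq : q * q = nu) by (apply sqrt_sqrt; lra).
  assert (Hss : s * s = 2 * nu) by (apply sqrt_sqrt; lra).
  assert (Hsq : q <= s) by (apply sqrt_le_1_alt; lra).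
  assert (Hiq : 0 < / q) by (apply Rinv_0_lt_compat; lra).
  assert (Hsx1 : 1 <= sqrt x) by (rewrite <- sqrt_1; now apply sqrt_le_1_alt).
  assert (Hsx : sqrt x * sqrt x = x) by (apply sqrt_sqrt; lra).
  assert (Hn0 : 0 <= n) by apply pos_INR.
  assert (Hiqq : / nu <= eta).
  { rewrite <- Hqq, Rinv_mult. nra. }
  assert (Hixq : / x <= eta).
  { assert (Hi : 0 < / sqrt x) by (apply Rinv_0_lt_compat; lra).
    unfold Rdiv in Hqx. rewrite <- Hsx, Rinv_mult. nra. }
  assert (Hi0 : 0 < / x) by (apply Rinv_0_lt_compat; lra).
  assert (Hinu0 : 0 < / nu) by (apply Rinv_0_lt_compat; lra).
  assert (E1 : n * (/ s) ^ 3 <= eta).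
  { apply Rle_trans with (/ q); [|exact Hq].
    assert (His : 0 < / s <= / q).
    { split; [apply Rinv_0_lt_compat; lra|apply Rinv_le_contravar; lra]. }
    replace ((/ s) ^ 3) with (/ (2 * nu) * / s) by (rewrite <- Hss; field; lra).
    rewrite Rinv_mult.
    assert (n * / nu <= 1).
    { apply (Rmult_le_reg_r nu); [lra|]. rewrite Rmult_assoc, Rinv_l by lra. lra. }
    assert (0 <= n * / nu) by (apply Rmult_le_pos; lra). nra. }
  assert (E2 : Rabs (1 - n * (2 + / x) * (/ s) ^ 2) <= 2 * eta).
  { replace ((/ s) ^ 2) with (/ (2 * nu)) by (rewrite <- Hss; field; lra).
    replace (1 - n * (2 + / x) * / (2 * nu))
      with ((nu - n) * / nu - (n * / nu) * / x / 2) by (field; lra).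
    assert (n * / nu <= 1).
    { apply (Rmult_le_reg_r nu); [lra|]. rewrite Rmult_assoc, Rinv_l by lra. lra. }
    assert (0 <= n * / nu) by (apply Rmult_le_pos; lra).
    apply Rabs_le. split; nra. }
  assert (Hlip : forall a b, Rabs (Phi a - Phi b) <= 1 * Rabs (a - b)).
  { apply (lipschitz_of_derive Phi gauss); [apply (cdf_derive Phi HPhi)|].
    intros y. rewrite Rabs_pos_eq by apply Rlt_le, gauss_pos. apply gauss_le_1. }
  assert (Hd : 0 < d) by (unfold d; lra).
  pose proof (Hlip (c + d) c) as L1. pose proof (Hlip (c - d) c) as L2.
  replace (c + d - c) with d in L1 by ring. replace (c - d - c) with (- d) in L2 by ring.
  rewrite Rabs_Ropp in L2. rewrite (Rabs_pos_eq d) in L1, L2 by lra.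
  apply Rabs_le_between in L1, L2.
  assert (Herr : C * (n * (/ s) ^ 3 + Rabs (1 - n * (2 + / x) * (/ s) ^ 2)) <= C * (3 * eta))
    by (apply Rmult_le_compat_l; lra).
  apply Rabs_def1; unfold d in *; lra.
Qed.

Lemma lan_remainder_negligible v :
  conv_prob_zero theta Delta
    (fun T l => ln (lik_ratio (theta + v / sqrt (T / Delta T / (2 * theta ^ 2)))
                              theta T (Delta T) l)
                - v * chi_stat (theta * Delta T) (T / Delta T) l + v ^ 2 / 2).
Proof.
  intros eps Heps tau Htau.
  pose proof (Rabs_pos v) as Hv. set (V := Rabs v) in *.
  assert (HV2 : v ^ 2 = V ^ 2) by (unfold V; now rewrite pow2_abs).
  pose proof (pow2_ge_0 V) as HVV.
  assert (HV3 : 0 <= V ^ 3) by now apply pow_le.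
  assert (HV4 : 0 <= V ^ 4) by now apply pow_le.
  (* The constants come from [Rabs h = V * sqrt 2 / q] with [sqrt 2 <= 1.5]: [5 * sqrt 2 ^ 3 <= 15],
     while 324 and 228 double to 648 and 456 through [h ^ 2 = 2 * V ^ 2 / nu] and
     [Rabs h <= 2 * V / q]. *)
  set (b := 3 * (15 * V ^ 3 + V ^ 2) / eps).
  set (A := 648 * V ^ 4 / eps ^ 2 + 456 * V / eps).
  assert (Hb : 0 <= b) by (apply Rle_mult_inv_pos; lra).
  assert (He2 : 0 < eps ^ 2) by now apply pow_lt.
  assert (HA : 0 <= A) by (apply Rplus_le_le_0_compat; apply Rle_mult_inv_pos; lra).
  (* [4 * V] secures [Rabs h <= / 2], [b] the deterministic condition of [remainder_prob], and
     [A / tau] the final probability bound. *)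
  set (eta := / (1 + 4 * V + b + A / tau)).
  destruct (inv_le_self_bounds (4 * V) b (A / tau) eta) as [Heta [He1 [Heb HeA]]];
    [lra|exact Hb|apply Rle_mult_inv_pos; lra|reflexivity|].
  assert (Heb' : (15 * V ^ 3 + V ^ 2) * eta <= eps / 3).
  { apply (Rmult_le_compat_l (eps / 3)) in Heb; [|lra].
    replace (eps / 3 * (b * eta)) with ((15 * V ^ 3 + V ^ 2) * eta) in Heb
      by (unfold b; field; lra). lra. }
  assert (HeA' : A * eta < tau).
  { apply (Rmult_lt_compat_l tau) in HeA; [|lra].
    replace (tau * (A / tau * eta)) with (A * eta) in HeA by (field; lra). lra. }
  destruct (Hreg eta ltac:(lra)) as [T0 HT0]. exists T0. intros T HT.
  destruct (HT0 T HT) as [Hx [Hnu [Hq Hqx]]].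
  pose proof (nobs_bounds T (Delta T) ltac:(lra)) as Hn.
  pose proof (remainder_prob theta T (Delta T) v Htheta Hx Hnu) as HP.
  cbv zeta in HP.
  set (nu := T / Delta T) in *. set (x := theta * Delta T) in *.
  set (n := INR (nobs T (Delta T))) in *.
  set (q := sqrt nu) in *. set (h := v * sqrt 2 / q) in *.
  assert (Hq1 : 1 <= q) by (unfold q; rewrite <- sqrt_1; now apply sqrt_le_1_alt).
  assert (Hqq : q * q = nu) by (apply sqrt_sqrt; lra).
  assert (Hiq : 0 < / q) by (apply Rinv_0_lt_compat; lra).
  assert (Hs2 : sqrt 2 * sqrt 2 = 2) by (apply sqrt_sqrt; lra).
  assert (Hs20 : 0 < sqrt 2) by (apply sqrt_lt_R0; lra).
  assert (Hs2u : sqrt 2 <= 1.5) by nra.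
  assert (Hsx0 : 0 < sqrt x) by (apply sqrt_lt_R0; lra).
  assert (Hn0 : 0 <= n) by apply pos_INR.
  assert (Hh : Rabs h = V * sqrt 2 * / q).
  { unfold h, Rdiv, V. rewrite !Rabs_mult, (Rabs_pos_eq (sqrt 2)), (Rabs_pos_eq (/ q)) by lra.
    reflexivity. }
  assert (Hh2 : h ^ 2 = 2 * V ^ 2 * (/ q * / q)).
  { rewrite <- pow2_abs, Hh.
    transitivity ((sqrt 2 * sqrt 2) * V ^ 2 * (/ q * / q)); [ring|]. now rewrite Hs2. }
  assert (Hhu : Rabs h <= 2 * V * / q) by (rewrite Hh; assert (0 <= V * / q) by nra; nra).
  assert (Hqq1 : / q * / q <= eta) by nra.
  assert (Hnq : n * / q <= q).
  { apply (Rmult_le_reg_r q); [lra|]. rewrite Rmult_assoc, Rinv_l by lra. lra. }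
  assert (Hnq0 : 0 <= n * / q) by (apply Rmult_le_pos; lra).
  assert (Hhalf : Rabs h <= / 2).
  { assert (V * / q <= V * eta) by (apply Rmult_le_compat_l; lra). nra. }
  assert (Hdet : 5 * n * Rabs h ^ 3 + v ^ 2 / (2 * nu) <= eps / 3).
  { eapply Rle_trans; [|exact Heb'].
    rewrite Rmult_plus_distr_r. apply Rplus_le_compat.
    - rewrite Hh. replace (5 * n * (V * sqrt 2 * / q) ^ 3)
        with (V ^ 3 * (5 * sqrt 2 * (sqrt 2 * sqrt 2)) * (n * / q * / q * / q)) by ring.
      rewrite Hs2.
      assert (n * / q * / q * / q <= eta).
      { apply Rle_trans with (q * / q * / q).
        - repeat (apply Rmult_le_compat_r; [lra|]). exact Hnq.
        - rewrite Rinv_r by lra. lra. }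
      assert (0 <= n * / q * / q * / q) by (apply Rmult_le_pos; [apply Rmult_le_pos|]; lra).
      rewrite (Rmult_comm 15), (Rmult_assoc _ 15), Rmult_assoc.
      apply Rmult_le_compat_l; [exact HV3|]. nra.
    - rewrite HV2. replace (V ^ 2 / (2 * nu)) with (V ^ 2 * (/ 2 * (/ q * / q)))
        by (rewrite <- Hqq; field; lra).
      apply Rmult_le_compat_l; [exact HVV|]. nra. }
  specialize (HP Hhalf eps Heps Hdet).
  assert (F1 : 324 * h ^ 2 * v ^ 2 / eps ^ 2 <= 648 * V ^ 4 / eps ^ 2 * eta).
  { rewrite Hh2, HV2.
    replace (324 * (2 * V ^ 2 * (/ q * / q)) * V ^ 2 / eps ^ 2)
      with (648 * V ^ 4 / eps ^ 2 * (/ q * / q)) by (field; lra).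
    apply Rmult_le_compat_l; [apply Rle_mult_inv_pos; lra|exact Hqq1]. }
  assert (F2 : 228 * Rabs h * n / (eps * sqrt x) <= 456 * V / eps * eta).
  { replace (228 * Rabs h * n / (eps * sqrt x)) with (228 / eps * (Rabs h * n * / sqrt x))
      by (field; lra).
    replace (456 * V / eps * eta) with (228 / eps * (2 * V * eta)) by (field; lra).
    apply Rmult_le_compat_l; [apply Rlt_le, Rdiv_lt_0_compat; lra|].
    assert (Hi : 0 < / sqrt x) by (apply Rinv_0_lt_compat; lra).
    apply Rle_trans with (2 * V * (q * / sqrt x)).
    - rewrite <- Rmult_assoc. apply Rmult_le_compat_r; [lra|].
      apply Rle_trans with (2 * V * / q * n); [apply Rmult_le_compat_r; lra|].
      replace (2 * V * / q * n) with (2 * V * (n * / q)) by ring.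
      apply Rmult_le_compat_l; lra.
    - apply Rmult_le_compat_l; [lra|exact Hqx]. }
  rewrite Rminus_0_r, Rabs_pos_eq by apply HP.
  eapply Rle_lt_trans; [apply HP|].
  unfold A in HeA'. lra.
Qed.

End Asymptotics.

Theorem theorem3 (Theta : R -> Prop)
  (HTopen : open_set Theta) (HTpos : forall t, Theta t -> 0 < t)
  (Delta : R -> R)
  (HD : diverges_at_infty Delta)
  (HTD : diverges_at_infty (fun T => T / Delta T))
  (Hrate : tends_at_infty
     (fun T => (T / Rpower (Delta T) (5 / 4))
               / Rpower (ln (T / Delta T)) (- (1 / 4))) 0) :
  forall theta, Theta theta ->
    LAN theta Delta (fun T => (T / Delta T) / (2 * theta ^ 2)).
Proof.
  intros theta Hth. pose proof (HTpos theta Hth) as Hpos.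
  assert (Hreg := fun eta Heta => regime Delta theta eta Hpos Heta HD HTD Hrate).
  exists (fun T => chi_stat (theta * Delta T) (T / Delta T)). split.
  - exact (chi_stat_normal Delta theta Hreg).
  - exact (lan_remainder_negligible Delta theta Hpos Hreg).
Qed.
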